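(* Let $d\ge2$, let $E\subset\mathbb{R}^d$ be a bounded Borel set with $|E|>0$, and for every measurable $F$ let $\mu(F)=|E\cap F|/|E|$. Assume there exists $c_1>0$ such that $c_1r^d\le\mu(B(x,r))$ for every $x\in E$ and every $0<r<\operatorname{diam}(E)$. Let $\Omega\subseteq\mathbb{R}^d$ be a bounded Borel set such that, for some $0<\beta\le1$ and $c'>0$, $|\{z\in\mathbb{R}^d:\operatorname{dist}(z,\partial\Omega)\le t\}|\le c' t^\beta$ for every $0<t<1$. Let $0<a<b$. Then there exists $c>0$ such that for every $N$ there exists a point distribution $\mathcal{P}_N=\{z_1,\dots,z_N\}\subset E$ with $$\left\{\int_a^b\int_{SO(d)}\int_{\mathbb{R}^d}\left|\mathcal{D}_N(x+\tau\sigma\Omega)\right|^2dx\,d\sigma\,d\tau\right\}^{1/2}\le c\,N^{1/2-\beta/(2d)}.$$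
   Context: $|F|$ is Lebesgue measure. $\mathcal{D}_N(R)=\mathrm{card}(\mathcal{P}_N\cap R)-N\mu(R)$. $d\sigma$ is normalized Haar measure on $SO(d)$. *)

(* Defs.v *)
From HB Require Import structures.
From mathcomp Require Import all_boot all_order all_algebra.
From mathcomp Require Import all_classical all_reals all_analysis.
Set Implicit Arguments. Unset Strict Implicit. Unset Printing Implicit Defensive.
Import Order.TTheory GRing.Theory Num.Theory.
Local Open Scope classical_set_scope.
Local Open Scope ring_scope.

(* Points of R^d are d-tuples of reals; d.-tuple R carries the product
   (= Borel) sigma-algebra of the library. *)
Section Defs.
Variable R : realType.
Variable d : nat.

Definition pt := d.-tuple R.

Definition enorm (v : pt) : R := Num.sqrt (\sum_(i < d) (tnth v i) ^+ 2).
Definition edist (x y : pt) : R :=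
  Num.sqrt (\sum_(i < d) (tnth x i - tnth y i) ^+ 2).

Definition eball (x : pt) (r : R) : set pt := [set y | edist x y < r].

Definition ebounded (A : set pt) : Prop :=
  exists M : R, forall x, A x -> enorm x <= M.

Definition ediam (A : set pt) : R :=
  sup [set edist x y | x in A & y in A].

Definition eboundary (A : set pt) : set pt :=
  [set z | forall e : R, 0 < e ->
     (exists y, A y /\ edist z y < e) /\ (exists y, ~ A y /\ edist z y < e)].

(* dist(z, A) = inf_{w in A} |z-w| in the extended reals (+oo if A empty) *)
Definition edist_set (z : pt) (A : set pt) : \bar R :=
  ereal_inf [set (edist z w)%:E | w in A].

Definition boundary_nbhd (A : set pt) (t : R) : set pt :=
  [set z | (edist_set z (eboundary A) <= t%:E)%E].

(* d x d matrices encoded as d-tuples of d-tuples (rows), so that they carry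
   the Borel sigma-algebra of R^(d*d). *)
Definition mx_of (m : d.-tuple pt) : 'M[R]_d := \matrix_(i, j) tnth (tnth m i) j.
Definition tuple_of_mx (M : 'M[R]_d) : d.-tuple pt :=
  [tuple [tuple M i j | j < d] | i < d].

Definition SOd : set 'M[R]_d := [set M | M^T *m M = 1%:M /\ \det M = 1].

Definition lmul (g : 'M[R]_d) (m : d.-tuple pt) : d.-tuple pt :=
  tuple_of_mx (g *m mx_of m).

Definition mxact (M : 'M[R]_d) (w : pt) : pt :=
  [tuple \sum_(j < d) M i j * tnth w j | i < d].

Definition vadd (x y : pt) : pt := [tuple tnth x i + tnth y i | i < d].
Definition vscale (s : R) (x : pt) : pt := [tuple s * tnth x i | i < d].

Definition moved (x : pt) (tau : R) (M : 'M[R]_d) (Om : set pt) : set pt :=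
  [set vadd x (vscale tau (mxact M w)) | w in Om].

(* Lebesgue measure on R^d: the measure giving closed boxes their volume
   (this uniquely determines it on the Borel sets). *)
Definition is_lebesgue_d (lam : set pt -> \bar R) : Prop :=
  forall a b : pt, (forall i, tnth a i <= tnth b i) ->
    lam [set x | forall i, tnth a i <= tnth x i <= tnth b i]
    = (\prod_(i < d) (tnth b i - tnth a i))%:E.

(* normalized Haar measure on SO(d): a probability measure on d x d matrices,
   concentrated on SO(d), invariant under left translations by SO(d)
   (this uniquely determines it). *)
Definition is_haar_SO (nu : set (d.-tuple pt) -> \bar R) : Prop :=
  nu [set m | ~ SOd (mx_of m)] = 0%E /\
  forall g, SOd g -> forall A : set (d.-tuple pt), measurable A ->
    nu (lmul g @^-1` A) = nu A.

Definition mu_E (lam : set pt -> \bar R) (E F : set pt) : R :=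
  fine (lam (E `&` F)) / fine (lam E).

Definition discrepancy (lam : set pt -> \bar R) (E : set pt) (N : nat)
  (z : 'I_N -> pt) (Rg : set pt) : R :=
  (#|[set i : 'I_N | `[< Rg (z i) >]]|)%:R - N%:R * mu_E lam E Rg.

End Defs.

(* Main.v *)
Require Import Defs.
From HB Require Import structures.
From mathcomp Require Import all_boot all_order all_algebra.
From mathcomp Require Import all_classical all_reals all_analysis.
From mathcomp Require Import measurable_realfun ring lra zify.
(* MathComp-Analysis also defines an [edist]. *)
Require Import Defs.
Set Implicit Arguments. Unset Strict Implicit. Unset Printing Implicit Defensive.
Import Order.TTheory GRing.Theory Num.Theory.
Local Open Scope classical_set_scope.
Local Open Scope ring_scope.

(* Enclose [E] in a cube and order its dyadic subcubes of a very fine generation [m] along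
   the Morton (bit-interleaving) curve, so that the descendants of every dyadic cube are
   consecutive. Cut the resulting order into [N] pieces of equal mass, cells being allowed
   to be shared fractionally, and choose one point independently in each piece. Given the
   moved set [F], a piece contributes to the variance only if it is cut by the boundary of
   [F]; for a piece of diameter [t] this happens for a set of translations [x] of measure
   O(t^beta). A piece has diameter larger than that of a cube of generation [k] only if it
   contains one of the at most 2^(dk) breaks between such cubes, so that the sum of the
   t^beta is O(N^(1 - beta/d)), because beta < d; no regularity of [E] is needed. In each
   cell only finitely many representatives are used, so the average over the random choice
   is a finite sum; the error this causes in the mean is killed by taking [m] large.
   The integral of a nonnegative function is a supremum over simple functions, hence
   monotone and superadditive even without measurability: a finite average can be moved
   inside the iterated integral without Fubini's theorem. *)

(** * Integrals of nonnegative, possibly nonmeasurable functions, as suprema over simple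
    functions *)

Section LowerIntegral.
Local Open Scope ereal_scope.
Import HBNNSimple.
Context d (T : measurableType d) (R : realType) (mu : {measure set T -> \bar R}).
Implicit Types (f g : T -> \bar R) (D : set T).

Lemma lower_integral_le D f g :
  (forall x, D x -> 0 <= f x) -> (forall x, D x -> f x <= g x) ->
  \int[mu]_(x in D) f x <= \int[mu]_(x in D) g x.
Proof.
move=> f0 fg.
have g0 x : D x -> 0 <= g x by move=> Dx; exact: le_trans (f0 x Dx) (fg x Dx).
rewrite !ge0_integralE//; apply: ge_ereal_sup => _ [h hf <-].
apply: ereal_sup_ubound; exists h => // x; apply: le_trans (hf x) _.
by rewrite /patch; case: ifPn => // /set_mem Dx; exact: fg.
Qed.

(** A simple function below [f] plus one below [g] is a simple function below [f + g]. The two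
    suprema are then taken one after the other, infinite values being treated apart because they
    cannot be subtracted. *)
Lemma lower_integralD D f g :
  (forall x, D x -> 0 <= f x) -> (forall x, D x -> 0 <= g x) ->
  \int[mu]_(x in D) f x + \int[mu]_(x in D) g x <=
  \int[mu]_(x in D) (f x + g x).
Proof.
move=> f0 g0.
have fg0 x : D x -> 0 <= f x + g x by move=> Dx; rewrite adde_ge0 ?f0 ?g0.
have h0 (h : {nnsfun T >-> R}) : 0 <= sintegral mu h by exact: sintegral_ge0.
set s := (leRHS); have s0 : 0 <= s by apply: integral_ge0.
have main (h k : {nnsfun T >-> R}) :
    (forall x, (h x)%:E <= (f \_ D) x) -> (forall x, (k x)%:E <= (g \_ D) x) ->
    sintegral mu h + sintegral mu k <= s.
  move=> hf kg; rewrite -sintegralD /s ge0_integralE//.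
  apply: ereal_sup_ubound; exists (add_nnsfun h k) => //= x.
  move: (hf x) (kg x); rewrite /patch EFinD; case: ifPn => // _ hx kx.
    exact: leeD.
  by rewrite -[leRHS]adde0; exact: leeD.
(* The supremum over [k], with [u] fixed. If [u] is infinite, the zero function as [k] already
   forces [s] to be infinite. *)
have step (u : \bar R) : 0 <= u -> (forall k : {nnsfun T >-> R},
    (forall x, (k x)%:E <= (g \_ D) x) -> u + sintegral mu k <= s) ->
    u + \int[mu]_(x in D) g x <= s.
  move=> u0 H; have [ufin|] := boolP (u \is a fin_num); last first.
    rewrite ge0_fin_numE// -leNgt leye_eq => /eqP uoo.
    have := H nnsfun0; rewrite uoo addye//; last by rewrite gt_eqF// (lt_le_trans _ (h0 _)) ?ltNy0.
    rewrite leye_eq => /(_ _)/eqP -> //; first exact: leey.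
    by move=> x; apply: erestrict_ge0.
  rewrite -leeBrDl// [X in X <= _]ge0_integralE//; apply: ge_ereal_sup => _ [k kg <-].
  by rewrite leeBrDl//; exact: H.
have gi0 : 0 <= \int[mu]_(x in D) g x by exact: integral_ge0.
have [gfin|] := boolP (\int[mu]_(x in D) g x \is a fin_num).
  rewrite -leeBrDr// [X in X <= _]ge0_integralE//; apply: ge_ereal_sup => _ [h hf <-].
  by rewrite leeBrDr//; apply: step => // k kg; exact: main.
(* If the integral of [g] is infinite, taking the zero function below [f] shows that [s] is infinite
   too. *)
rewrite ge0_fin_numE// -leNgt leye_eq => /eqP goo.
have : 0 + \int[mu]_(x in D) g x <= s.
  apply: step => // k kg; rewrite add0e -[leLHS]add0e -(@sintegral0 _ _ _ mu).
  by apply: (main nnsfun0) => // x; apply: erestrict_ge0.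
by rewrite add0e goo leye_eq => /eqP ->; rewrite leey.
Qed.

Lemma lower_integralZ D f (p : R) : (0 <= p)%R ->
  (forall x, D x -> 0 <= f x) ->
  p%:E * \int[mu]_(x in D) f x <= \int[mu]_(x in D) (p%:E * f x).
Proof.
move=> p0 f0; have pf0 x : D x -> 0 <= p%:E * f x.
  by move=> Dx; rewrite mule_ge0 ?f0 ?lee_fin.
have [->|pn0] := eqVneq p 0%R.
  by rewrite mul0e; under eq_integral do rewrite mul0e; rewrite integral0.
have pp : (0 < p)%R by rewrite lt_neqAle eq_sym pn0.
rewrite muleC -lee_pdivlMr// [X in X <= _]ge0_integralE//.
apply: ge_ereal_sup => _ [h hf <-]; rewrite lee_pdivlMr// muleC -sintegralrM.
rewrite ge0_integralE//; apply: ereal_sup_ubound.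
exists (scale_nnsfun h p0) => //= x; rewrite EFinM.
move: (hf x); rewrite /patch; case: ifPn => _ hx; first by rewrite lee_wpmul2l ?lee_fin.
by rewrite mule_ge0_le0 ?lee_fin.
Qed.

Lemma lower_integral_sum D (I : Type) (s : seq I) (p : I -> R)
    (f : I -> T -> \bar R) :
  (forall i, 0 <= p i)%R -> (forall i x, D x -> 0 <= f i x) ->
  \sum_(i <- s) (p i)%:E * \int[mu]_(x in D) f i x <=
  \int[mu]_(x in D) \sum_(i <- s) (p i)%:E * f i x.
Proof.
move=> p0 f0; have pf0 i x : D x -> 0 <= (p i)%:E * f i x.
  by move=> Dx; rewrite mule_ge0 ?f0 ?lee_fin.
elim: s => [|i s IH]; first by rewrite big_nil integral_ge0// => x _; rewrite big_nil.
rewrite big_cons; apply: le_trans (leeD (lower_integralZ (p0 i) (f0 i)) IH) _.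
under [leRHS]eq_integral do rewrite big_cons.
apply: lower_integralD => x Dx; first exact: pf0.
by apply: sume_ge0 => j _; exact: pf0.
Qed.

Lemma lower_integral_le_cst D f (C : R) : measurable D -> (0 <= C)%R ->
  (forall x, D x -> 0 <= f x) -> (forall x, D x -> f x <= C%:E) ->
  \int[mu]_(x in D) f x <= C%:E * mu D.
Proof.
move=> mD C0 f0 fC; rewrite -integral_cst//.
exact: lower_integral_le.
Qed.

(** The function equal to [C] off [B] and to [+oo] on [B] dominates [f] and is measurable, so its
    integral can be computed. *)
Lemma lower_integral_le_ae f (C : R) (B : set T) : measurable B -> (0 <= C)%R ->
  mu B = 0 -> (forall x, 0 <= f x) -> (forall x, ~ B x -> f x <= C%:E) ->
  \int[mu]_(x in setT) f x <= C%:E * mu setT.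
Proof.
move=> mB C0 B0 f0 fC.
apply: (@le_trans _ _ (\int[mu]_(x in setT) (C%:E + +oo * (\1_B x)%:E))).
  apply: lower_integral_le => // x _; rewrite indicE.
  have [xB|xB] := boolP (x \in B); first by rewrite /= mule1 addey// leey.
  by rewrite mule0 adde0; apply: fC => Bx; move: xB; rewrite mem_set.
have m1 : measurable_fun [set: T] (EFin \o (\1_B : T -> R)).
  by apply/measurable_EFinP; exact: measurable_indic.
have i0 x : 0 <= (\1_B x : R)%:E by rewrite lee_fin.
rewrite ge0_integralD//=; [|exact: measurable_funeM].
rewrite integral_cst// ge0_integralZl//.
by rewrite integral_indic// setIT B0 mule0 adde0.
Qed.

End LowerIntegral.

(** * The Euclidean distance on tuples *)

Section Euclid.
Context (R : realType) (d : nat).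
Implicit Types x y z : d.-tuple R.

Lemma edist_ge0 x y : 0 <= edist x y.
Proof. exact: sqrtr_ge0. Qed.

Lemma edistC x y : edist x y = edist y x.
Proof.
by rewrite /edist; congr Num.sqrt; apply: eq_bigr => i _; rewrite -opprB sqrrN.
Qed.

Lemma sqr_edist x y : edist x y ^+ 2 = \sum_(i < d) (tnth x i - tnth y i) ^+ 2.
Proof. by rewrite sqr_sqrtr// sumr_ge0// => i _; rewrite sqr_ge0. Qed.

Lemma coord_le_edist x y i : `|tnth x i - tnth y i| <= edist x y.
Proof.
rewrite -sqrtr_sqr ler_wsqrtr// (bigD1 i)//= lerDl.
by apply: sumr_ge0 => j _; rewrite sqr_ge0.
Qed.

Lemma edist_le_coord x y s : 0 <= s ->
  (forall i, `|tnth x i - tnth y i| <= s) -> edist x y <= d%:R * s.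
Proof.
move=> s0 H; rewrite -(ler_pXn2r (n := 2)) ?nnegrE ?edist_ge0 ?mulr_ge0//.
rewrite sqr_edist; apply: (@le_trans _ _ (\sum_(i < d) s ^+ 2)).
  apply: ler_sum => i _; rewrite -real_normK ?num_real//.
  by rewrite ler_pXn2r ?nnegrE ?normr_ge0.
rewrite sumr_const card_ord exprMn -[leLHS]mulr_natl ler_wpM2r ?sqr_ge0//.
by rewrite -natrX ler_nat; case: d => // n; rewrite expnS leq_pmulr// expn_gt0.
Qed.

Lemma sum_sqr_triangle (u v : 'I_d -> R) :
  Num.sqrt (\sum_i (u i + v i) ^+ 2) <=
  Num.sqrt (\sum_i u i ^+ 2) + Num.sqrt (\sum_i v i ^+ 2).
Proof.
set U := \sum_i u i ^+ 2; set V := \sum_i v i ^+ 2.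
have s0 (w : 'I_d -> R) : 0 <= \sum_i w i ^+ 2.
  by apply: sumr_ge0 => i _; rewrite sqr_ge0.
pose A := Num.sqrt U; pose B := Num.sqrt V.
have A0 : 0 <= A by exact: sqrtr_ge0.
have B0 : 0 <= B by exact: sqrtr_ge0.
have A2 : A ^+ 2 = U by rewrite sqr_sqrtr ?s0.
have B2 : B ^+ 2 = V by rewrite sqr_sqrtr ?s0.
have z0 (w : 'I_d -> R) i : \sum_i w i ^+ 2 = 0 -> w i = 0.
  move=> e; have /eqP := psumr_eq0P (fun j _ => sqr_ge0 (w j)) e (i := i) isT.
  by rewrite sqrf_eq0 => /eqP.
(* Cauchy-Schwarz: the sum of the squares of [B * u i - A * v i] is [2 * (A * B)] times the
   difference of the two sides. If [A * B = 0], one of the vectors vanishes. *)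
have CS : \sum_i u i * v i <= A * B.
  have [AB0|AB0] := eqVneq (A * B) 0.
    rewrite AB0 big1// => i _; move/eqP: AB0; rewrite mulf_eq0 => /orP[]/eqP E.
      by rewrite (z0 u) ?mul0r// -/U -A2 E expr0n.
    by rewrite (z0 v) ?mulr0// -/V -B2 E expr0n.
  have ABp : 0 < A * B by rewrite lt_neqAle eq_sym AB0 mulr_ge0.
  have : 0 <= \sum_i (B * u i - A * v i) ^+ 2 by exact: s0.
  rewrite (_ : \sum_i _ = B ^+ 2 * U + A ^+ 2 * V - 2 * (A * B) * \sum_i u i * v i).
    by rewrite -A2 -B2 => H; rewrite -(ler_pM2l ABp); nra.
  rewrite !mulr_sumr -sumrN -!big_split/=; apply: eq_bigr => i _; ring.
rewrite -(ler_pXn2r (n := 2)) ?nnegrE ?addr_ge0 ?sqrtr_ge0//.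
rewrite sqr_sqrtr ?s0// -/A -/B sqrrD A2 B2.
rewrite (_ : \sum_i _ = U + (\sum_i u i * v i) *+ 2 + V).
  by rewrite lerD2r lerD2l lerMn2r CS.
rewrite -mulr_natl mulr_sumr -!big_split/=; apply: eq_bigr => i _; ring.
Qed.

Lemma edist_triangle x y z : edist x z <= edist x y + edist y z.
Proof.
rewrite /edist; apply: le_trans (sum_sqr_triangle _ _).
by rewrite le_eqVlt; apply/orP; left; apply/eqP; congr Num.sqrt; apply: eq_bigr => i _;
  congr (_ ^+ 2); ring.
Qed.

End Euclid.

(** * Dyadic cells and their Morton numbering *)

Section Morton.
Context (R : realType) (d : nat) (L : R).
Implicit Types x y z : d.-tuple R.

Definition nchild := #|{ffun 'I_d -> bool}|.

Definition orthant x : {ffun 'I_d -> bool} := [ffun i => 0 <= tnth x i].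

(* The affine expansion of the orthant of [x] in the cube of half side [L] onto the cube. *)
Definition zoom x : d.-tuple R :=
  [tuple 2 * tnth x i + (if 0 <= tnth x i then - L else L) | i < d].

(* The first [m] digits, in base [nchild = 2 ^ d], of the position of [x] along the
   Morton curve. *)
Fixpoint morton m x : nat :=
  if m is k.+1 then enum_rank (orthant x) * nchild ^ k + morton k (zoom x) else 0.

Definition cube x := forall i, - L <= tnth x i <= L.

Lemma nchildE : nchild = (2 ^ d)%N.
Proof. by rewrite /nchild card_ffun card_bool card_ord. Qed.

Lemma nchild_gt0 : (0 < nchild)%N.
Proof. by rewrite nchildE expn_gt0. Qed.

Lemma morton_lt m x : (morton m x < nchild ^ m)%N.
Proof.
elim: m x => [//|m IH] x /=; have := IH (zoom x).
have := ltn_ord (enum_rank (orthant x)); rewrite -/nchild expnS => h1 h2.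
apply: leq_trans (_ : (enum_rank (orthant x)).+1 * nchild ^ m <= _)%N.
  by rewrite mulSn addnC ltn_add2r.
by rewrite leq_mul2r h1 orbT.
Qed.

Lemma morton_parent m x : (morton m.+1 x %/ nchild = morton m x)%N.
Proof.
elim: m x => [|m IH] x.
  by rewrite /= expn0 muln1 addn0 divn_small// ltn_ord.
have -> : morton m.+2 x =
    (enum_rank (orthant x) * nchild ^ m.+1 + morton m.+1 (zoom x))%N by [].
by rewrite expnSr mulnA divnMDl ?nchild_gt0// IH.
Qed.

(** Dropping the last [m - k] digits leads to the ancestor of generation [k], so the descendants of
    a cube have consecutive numbers. *)
Lemma morton_ancestor k m x : (k <= m)%N ->
  (morton m x %/ nchild ^ (m - k) = morton k x)%N.
Proof.
move=> /subnKC <-; rewrite addKn; elim: (m - k)%N => [|j IH].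
  by rewrite addn0 divn1.
by rewrite expnS divnMA addnS morton_parent IH.
Qed.

Lemma zoom_cube x : cube x -> cube (zoom x).
Proof.
by move=> cx i; have := cx i; rewrite tnth_mktuple; case: ifPn => [?|]; rewrite -?ltNge; lra.
Qed.

Lemma morton_eqS m x y : morton m.+1 x = morton m.+1 y ->
  orthant x = orthant y /\ morton m (zoom x) = morton m (zoom y).
Proof.
move=> /= e; have D0 : (0 < nchild ^ m)%N by rewrite expn_gt0 nchild_gt0.
have e1 := congr1 (divn^~ (nchild ^ m)%N) e; have e2 := congr1 (modn^~ (nchild ^ m)%N) e.
move: e1 e2; rewrite /= !divnMDl// !divn_small ?morton_lt// !addn0.
by rewrite !modnMDl !modn_small ?morton_lt// => /val_inj/enum_rank_inj.
Qed.

(** On points of a common orthant [zoom] doubles every coordinate difference, and after [m] zooms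
    the points still lie in a cube of side [2 * L]. *)
Lemma morton_close m x y : cube x -> cube y -> morton m x = morton m y ->
  forall i, `|tnth x i - tnth y i| <= 2 * L / 2 ^+ m.
Proof.
elim: m x y => [|m IH] x y cx cy.
  by move=> _ i; rewrite expr0 divr1 ler_norml; have := cx i; have := cy i; lra.
move=> /morton_eqS[eo e] i; have := IH _ _ (zoom_cube cx) (zoom_cube cy) e i.
rewrite !tnth_mktuple; have /ffunP/(_ i) := eo; rewrite !ffunE => ->.
rewrite opprD addrACA subrr addr0 -mulrBr normrM (ger0_norm (x := 2))//.
by rewrite exprS invfM mulrCA -ler_pdivlMl// [2^-1 * _]mulrC mulrC.
Qed.

(** A closed box of half the side of the cell fits inside it. This bounds the volume of a cell from
    below without deciding which of its faces belong to it. *)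
Lemma morton_box m y : 0 < L -> cube y -> exists p : d.-tuple R, forall x,
  (forall i, tnth p i <= tnth x i <= tnth p i + L / 2 ^+ m) ->
  cube x /\ morton m x = morton m y.
Proof.
(* The strict upper bound is what the induction needs: once the box is shrunk into a negative half,
   it must avoid the value 0, which counts as nonnegative in [orthant]. *)
move=> L0; suff H : cube y -> exists p : d.-tuple R, 
   (forall i, - L <= tnth p i /\ tnth p i + L / 2 ^+ m < L) /\
   forall x, (forall i, tnth p i <= tnth x i <= tnth p i + L / 2 ^+ m) ->
    morton m x = morton m y.
  move=> /H[p [pL pm]]; exists p => x px; split; last exact: pm.
  by move=> i; have := pL i; have := px i; lra.
elim: m y => [|m IH] y cy.
  exists [tuple - L | i < d]; split=> // i.
  by rewrite tnth_mktuple expr0; lra.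
have [q [qL qm]] := IH _ (zoom_cube cy).
have h0 : L / 2 ^+ m = 2 * (L / 2 ^+ m.+1).
  by rewrite exprS invfM mulrCA mulVKf.
set h := L / 2 ^+ m.+1 in h0 *; have hp : 0 < h by rewrite divr_gt0// exprn_gt0.
exists [tuple (tnth q i + (if 0 <= tnth y i then L else - L)) / 2 | i < d]; split.
  move=> i; have := qL i; rewrite tnth_mktuple h0; case: ifPn => _ [? ?]; split; lra.
move=> x xq; have ox : orthant x = orthant y.
  apply/ffunP => i; rewrite !ffunE; have := xq i; have := qL i.
  rewrite tnth_mktuple h0; case: ifPn => yi [q1 q2] /andP[x1 x2].
    by lra.
  by apply/negbTE; rewrite -ltNge; lra.
have zx : morton m (zoom x) = morton m (zoom y).
  apply: qm => i; rewrite tnth_mktuple h0.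
  have /ffunP/(_ i) := ox; rewrite !ffunE => ->.
  by have := xq i; rewrite tnth_mktuple; case: ifPn => _; lra.
by rewrite /= ox zx.
Qed.

Lemma measurable_coord i : measurable_fun [set: d.-tuple R] (fun x => tnth x i).
Proof. exact: measurable_tnth. Qed.

Lemma measurable_mktuple d' (T : measurableType d') (f : 'I_d -> T -> R) :
  (forall i, measurable_fun setT (f i)) ->
  measurable_fun setT (fun t => [tuple f i t | i < d]).
Proof.
move=> mf; apply/measurable_fun_tnthP => i.
rewrite (_ : _ \o _ = f i)//; apply/funext => t /=; exact: tnth_mktuple.
Qed.

Lemma measurable_zoom : measurable_fun setT zoom.
Proof.
apply: measurable_mktuple => i; apply: measurable_funD.
  by apply: measurable_funM => //; exact: measurable_coord.
apply: measurable_fun_if => //.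
by apply: measurable_fun_ler => //; exact: measurable_coord.
Qed.

Lemma measurable_orthant v : measurable [set x | orthant x = v].
Proof.
rewrite (_ : [set x | _] = \bigcap_(i in [set: 'I_d]) [set x | (0 <= tnth x i) = v i]).
  apply: fin_bigcap_measurable => // i _.
  have m0 : measurable_fun setT (fun x : d.-tuple R => 0 <= tnth x i).
    by apply: measurable_fun_ler => //; exact: measurable_coord.
  have := m0 measurableT [set v i]; rewrite setTI; exact.
apply/seteqP; split=> [x <- i _ /=|x H]; first by rewrite ffunE.
by apply/ffunP => i; rewrite ffunE; exact: H.
Qed.

Lemma measurable_morton m n : measurable [set x | morton m x = n].
Proof.
elim: m n => [|m IH] n.
  have [->|n0] := eqVneq n 0%N; first by rewrite (_ : [set _ | _] = setT)//; apply/seteqP; split.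
  rewrite (_ : [set _ | _] = set0)//; apply/seteqP; split=> // x /= e.
  by rewrite -e eqxx in n0.
have D0 : (0 < nchild ^ m)%N by rewrite expn_gt0 nchild_gt0.
rewrite (_ : [set _ | _] = (\bigcup_(v in [set v | (enum_rank v : nat) = (n %/ nchild ^ m)%N])
    [set x | orthant x = v]) `&` zoom @^-1` [set x | morton m x = (n %% nchild ^ m)%N]).
  apply: measurableI; last by rewrite -[X in measurable X]setTI; exact: measurable_zoom.
  by apply: fin_bigcup_measurable => // v _; exact: measurable_orthant.
apply/seteqP; split=> [x /= <-|x [[v /= vn ov] /= zm]].
  rewrite divnMDl// modnMDl divn_small ?modn_small ?morton_lt// addn0.
  by split => //; exists (orthant x).
by rewrite ov vn zm -divn_eq.
Qed.

End Morton.

(** * Undoing the similarity that moves the set *)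

Section Pull.
Context (R : realType) (d : nat).
Implicit Types (x y u : d.-tuple R) (M : 'M[R]_d) (w : 'I_d -> R).

(* The inverse of the motion [w |-> x + tau M w] when [M] is orthogonal. *)
Definition pull M (tau : R) x y : d.-tuple R :=
  [tuple tau^-1 * \sum_(j < d) M j i * (tnth y j - tnth x j) | i < d].

Lemma orthogonal_sumK M w i : M^T *m M = 1%:M ->
  \sum_j M j i * (\sum_k M j k * w k) = w i.
Proof.
move=> MM; transitivity (\sum_k (M^T *m M) i k * w k).
  under eq_bigr do rewrite mulr_sumr.
  rewrite exchange_big; apply: eq_bigr => k _ /=; rewrite !mxE mulr_suml.
  by apply: eq_bigr => j _; rewrite mxE mulrA.
rewrite MM (bigD1 i)//= mxE eqxx mul1r big1 ?addr0// => k ki.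
by rewrite mxE eq_sym (negbTE ki) mul0r.
Qed.

Lemma orthogonal_sumKV M w i : M^T *m M = 1%:M ->
  \sum_j M i j * (\sum_k M k j * w k) = w i.
Proof.
move=> /mulmx1C MM; rewrite -[RHS](@orthogonal_sumK M^T) ?trmxK//.
by apply: eq_bigr => j _; rewrite mxE; congr (_ * _); apply: eq_bigr => k _; rewrite mxE.
Qed.

Lemma orthogonal_sqr M w : M^T *m M = 1%:M ->
  \sum_i (\sum_j M j i * w j) ^+ 2 = \sum_i w i ^+ 2.
Proof.
move=> MM; transitivity (\sum_j w j * \sum_i M j i * (\sum_k M k i * w k)).
  under eq_bigr do rewrite expr2 mulr_suml.
  rewrite exchange_big; apply: eq_bigr => j _; rewrite mulr_sumr.
  by apply: eq_bigr => i _; rewrite mulrA [w j * _]mulrC.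
by apply: eq_bigr => j _; rewrite orthogonal_sumKV.
Qed.

(** Turns a question about the moved set into one about the fixed set [Om]. *)
Lemma moved_pull M tau x (Om : set (d.-tuple R)) y : M^T *m M = 1%:M -> tau != 0 ->
  moved x tau M Om y <-> Om (pull M tau x y).
Proof.
move=> MM t0; split=> [[w Omw <-]|Omp].
  suff -> : pull M tau x (vadd x (vscale tau (mxact M w))) = w by [].
  apply: eq_from_tnth => i; rewrite tnth_mktuple.
  rewrite -[RHS](orthogonal_sumK (fun k => tnth w k) i MM) mulr_sumr.
  by apply: eq_bigr => j _; rewrite !tnth_mktuple addrC addKr mulrCA mulKf.
exists (pull M tau x y) => //; apply: eq_from_tnth => i; rewrite !tnth_mktuple.
rewrite mulr_sumr -[RHS](subrK (tnth x i)) addrC; congr (_ + _).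
rewrite -[RHS](orthogonal_sumKV (fun k => tnth y k - tnth x k) i MM).
by apply: eq_bigr => j _; rewrite tnth_mktuple mulrCA mulVKf.
Qed.

Lemma edist_pull M tau x y x' y' : M^T *m M = 1%:M -> 0 < tau ->
  tau * edist (pull M tau x y) (pull M tau x' y') =
  Num.sqrt (\sum_j ((tnth y j - tnth x j) - (tnth y' j - tnth x' j)) ^+ 2).
Proof.
move=> MM t0; rewrite -(orthogonal_sqr _ MM) -[X in X * _](gtr0_norm t0).
rewrite -sqrtr_sqr -sqrtrM ?sqr_ge0//.
congr Num.sqrt; rewrite mulr_sumr; apply: eq_bigr => i _.
rewrite !tnth_mktuple -mulrBr -exprMn mulVKf ?gt_eqF//; congr (_ ^+ 2).
by rewrite -sumrB; apply: eq_bigr => j _; rewrite -mulrBr.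
Qed.

Lemma edist_pull_point M tau x y y' : M^T *m M = 1%:M -> 0 < tau ->
  tau * edist (pull M tau x y) (pull M tau x y') = edist y y'.
Proof.
move=> MM t0; rewrite edist_pull//; congr Num.sqrt.
by apply: eq_bigr => j _; congr (_ ^+ 2); ring.
Qed.

(** [pull] depends on [y] and [x] only through [y - x], so it is a similarity in the translation as
    well; the volume of a set of translations can thus be compared with that of its image. *)
Lemma edist_pull_center M tau x x' y : M^T *m M = 1%:M -> 0 < tau ->
  tau * edist (pull M tau x y) (pull M tau x' y) = edist x x'.
Proof.
move=> MM t0; rewrite edist_pull// edistC; congr Num.sqrt.
by apply: eq_bigr => j _; congr (_ ^+ 2); ring.
Qed.

Lemma measurable_pull_point M tau x : measurable_fun setT (pull M tau x).
Proof.
apply: measurable_mktuple => i; apply: measurable_funM => //.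
apply: measurable_sum => j; apply: measurable_funM => //.
by apply: measurable_funB => //; exact: measurable_coord.
Qed.

Lemma measurable_pull_center M tau y : measurable_fun setT (fun x => pull M tau x y).
Proof.
apply: measurable_mktuple => i; apply: measurable_funM => //.
apply: measurable_sum => j; apply: measurable_funM => //.
by apply: measurable_funB => //; exact: measurable_coord.
Qed.

Lemma measurable_moved M tau x (Om : set (d.-tuple R)) :
  M^T *m M = 1%:M -> tau != 0 -> measurable Om -> measurable (moved x tau M Om).
Proof.
move=> MM t0 mOm; rewrite (_ : moved _ _ _ _ = pull M tau x @^-1` Om).
  by rewrite -[X in measurable X]setTI; exact: measurable_pull_point.
by apply/seteqP; split=> y /(moved_pull x Om y MM t0).
Qed.

End Pull.

(** * Boundaries and their neighbourhoods *)

Section Boundary.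
Context (R : realType) (d : nat).
Implicit Types (x y z p q w : d.-tuple R) (A : set (d.-tuple R)).

Lemma eboundaryC A : eboundary (~` A) = eboundary A.
Proof.
apply/seteqP; split=> z Hz e e0; have [[y [Ay yz]] [y' [Ay' yz']]] := Hz e e0.
  by split; [exists y'; split=> //; exact: contrapT|exists y].
by split; [exists y'|exists y; split=> //; exact].
Qed.

(** On the segment from [p] to [q], the point whose parameter is the supremum of the parameters of
    points of [A] is a boundary point. *)
Lemma segment_boundary_in A p q : A p -> ~ A q ->
  exists2 w, eboundary A w & edist p w <= edist p q.
Proof.
move=> Ap Aq.
pose f (s : R) : d.-tuple R := [tuple tnth p i + s * (tnth q i - tnth p i) | i < d].
have f0 : f 0 = p by apply: eq_from_tnth => i; rewrite tnth_mktuple mul0r addr0.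
have f1 : f 1 = q by apply: eq_from_tnth => i; rewrite tnth_mktuple mul1r addrC subrK.
have fd s s' : edist (f s) (f s') = `|s - s'| * edist p q.
  rewrite -sqrtr_sqr -sqrtrM ?sqr_ge0//; congr Num.sqrt; rewrite mulr_sumr.
  by apply: eq_bigr => i _; rewrite !tnth_mktuple; ring.
pose S := [set s : R | 0 <= s <= 1 /\ A (f s)].
have S0 : S 0 by split; [lra|rewrite f0].
have supS : has_sup S by split; [exists 0|exists 1 => s [/andP[]]].
set s0 := sup S.
have s00 : 0 <= s0 by exact: sup_upper_bound.
have s01 : s0 <= 1 by apply: ge_sup; [exists 0|move=> s [/andP[]]].
exists (f s0); last first.
  by rewrite -{1}f0 fd sub0r normrN ger0_norm// ler_piMl// edist_ge0.
move=> e e0; pose D := edist p q + 1.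
have D0 : 0 < D by rewrite ltr_wpDl// edist_ge0.
have close s : `|s0 - s| <= e / 2 / D -> edist (f s0) (f s) < e.
  move=> H; rewrite fd; apply: (@le_lt_trans _ _ (e / 2 / D * D)).
    apply: ler_pM => //; rewrite ?edist_ge0// /D; lra.
  rewrite divfK ?gt_eqF//; lra.
have h0 : 0 < e / 2 / D by rewrite !divr_gt0.
split.
  have [s Ss] := sup_adherent h0 supS; rewrite -/s0 => ss0.
  exists (f s); split; [exact: Ss.2|apply: close].
  have ss : s <= s0 by exact: sup_upper_bound.
  by rewrite ger0_norm; lra.
(* A parameter beyond the supremum gives a point outside [A]; where it would exceed 1, the end point
   [q] serves instead. *)
exists (f (Num.min 1 (s0 + e / 2 / D))); split.
  rewrite /Num.min; case: ifPn => [_|]; first by rewrite f1.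
  rewrite -leNgt => H Af; suff : s0 + e / 2 / D <= s0 by lra.
  by apply: sup_upper_bound => //; split => //; lra.
apply: close; rewrite distrC ger0_norm /Num.min; case: ifPn; rewrite -?leNgt => ?; lra.
Qed.

Lemma segment_boundary A p q : ~ (A p <-> A q) ->
  exists2 w, eboundary A w & edist p w <= edist p q.
Proof.
move=> H; have [Ap|Ap] := pselect (A p).
  by apply: segment_boundary_in => // Aq; apply: H.
have [Aq|Aq] := pselect (A q); last by exfalso; apply: H.
rewrite -eboundaryC; apply: segment_boundary_in => //; exact.
Qed.

Lemma boundary_nbhdP A (t : R) z : boundary_nbhd A t z <->
  forall e, 0 < e -> exists2 w, eboundary A w & edist z w < t + e.
Proof.
split=> [H e e0|H].
  have : (edist_set z (eboundary A) < (t + e)%:E)%E.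
    by apply: le_lt_trans H _; rewrite lte_fin ltrDl.
  by move=> /ereal_inf_lt[_ [w Aw <-]]; rewrite lte_fin => ?; exists w.
apply/lee_addgt0Pr => e e0; have [w Aw zw] := H e e0.
apply: (@le_trans _ _ (edist z w)%:E); last by rewrite -EFinD lee_fin ltW.
by apply: ereal_inf_lbound; exists w.
Qed.

Lemma boundary_nbhd_edist A s t z z' : boundary_nbhd A s z ->
  edist z' z <= t -> boundary_nbhd A (s + t) z'.
Proof.
move=> /boundary_nbhdP H zz; apply/boundary_nbhdP => e /H[w Aw zw]; exists w => //.
by have := edist_triangle z' z w; lra.
Qed.

Lemma boundary_nbhd_closed A t z :
  (forall e, 0 < e -> exists2 y, boundary_nbhd A t y & edist z y < e) ->
  boundary_nbhd A t z.
Proof.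
move=> H; apply/boundary_nbhdP => e e0.
have e2 : 0 < e / 2 by lra.
have [y Ay zy] := H _ e2; have := boundary_nbhd_edist Ay (ltW zy).
by move=> /boundary_nbhdP/(_ _ e2)[w Aw zw]; exists w => //; lra.
Qed.

Lemma ebounded_coord A : ebounded A ->
  exists2 L : R, 0 < L & forall x i, A x -> `|tnth x i| <= L.
Proof.
move=> [M HM]; exists (`|M| + 1) => [|x i Ax]; first by rewrite ltr_wpDl.
apply: (@le_trans _ _ (enorm x)).
  rewrite -sqrtr_sqr ler_wsqrtr// (bigD1 i)//= lerDl.
  by apply: sumr_ge0 => j _; rewrite sqr_ge0.
by apply: le_trans (HM x Ax) _; have := ler_norm M; lra.
Qed.

Lemma boundary_nbhd_cube A T : 0 <= T -> ebounded A ->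
  exists2 L : R, 0 < L & forall t, t <= T -> boundary_nbhd A t `<=` cube L.
Proof.
(* Beyond [L + T], one unit pays for the slack in the distance to the boundary and one for the way
   from the boundary to a point of [A]. *)
move=> T0 /ebounded_coord[L L0 HL]; exists (L + T + 2) => [|t tT z]; first lra.
move=> /boundary_nbhdP/(_ 1 ltr01)[w Aw zw] i; have [[y [Ay wy]] _] := Aw 1 ltr01.
have := coord_le_edist z w i; have := coord_le_edist w y i; have := HL y i Ay.
rewrite -ler_norml => h1 h2 h3.
rewrite (_ : tnth z i = (tnth z i - tnth w i) + (tnth w i - tnth y i) + tnth y i); last by ring.
have := ler_normD (tnth z i - tnth w i + (tnth w i - tnth y i)) (tnth y i).
have := ler_normD (tnth z i - tnth w i) (tnth w i - tnth y i); lra.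
Qed.

End Boundary.

(** * Measurability and volume by means of dyadic cells *)

Section Covering.
Context (R : realType) (d : nat) (L : R).
Implicit Types (x y z u : d.-tuple R) (A B : set (d.-tuple R)) (m n : nat).

Definition cell m n : set (d.-tuple R) := [set x | morton L m x = n].

Lemma measurable_cell m n : measurable (cell m n).
Proof. exact: measurable_morton. Qed.

Lemma measurable_cells m (S : set nat) : measurable [set x : d.-tuple R | S (morton L m x)].
Proof.
rewrite (_ : [set x | S (morton L m x)] = \bigcup_(n in S) cell m n).
  by apply: bigcup_measurable => n _; exact: measurable_cell.
by apply/seteqP; split=> [x Sx|x [n Sn /= xn]]; [exists (morton L m x)|rewrite xn].
Qed.

Lemma measurable_cube : measurable (@cube R d L).
Proof.
rewrite (_ : @cube R d L = \bigcap_(i in [set: 'I_d]) [set x | - L <= tnth x i <= L]).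
  apply: fin_bigcap_measurable => // i _.
  have := @measurable_coord R d i measurableT `[- L, L]%classic (measurable_itv _).
  by rewrite setTI set_itvcc.
by apply/seteqP; split=> x H i; [move=> _|]; exact: H.
Qed.

Lemma exp2_small (C e : R) : 0 < e -> exists m, C / 2 ^+ m < e.
Proof.
move=> e0; have p2 m : 0 < 2 ^+ m :> R by rewrite exprn_gt0.
exists (Num.truncn (`|C| / e)).+1; rewrite ltr_pdivrMr// mulrC -ltr_pdivrMr//.
apply: le_lt_trans (_ : `|C| / e < _).
  by rewrite ler_wpM2r ?invr_ge0 ?(ltW e0)// ler_norm.
apply: lt_trans (truncnS_gt _) _.
by rewrite -natrX ltr_nat ltn_expl.
Qed.

Lemma edist_cell m x y : 0 <= L -> cube L x -> cube L y ->
  morton L m x = morton L m y -> edist x y <= d%:R * (2 * L / 2 ^+ m).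
Proof.
move=> L0 cx cy e; apply: edist_le_coord; last exact: morton_close.
by rewrite divr_ge0 ?exprn_ge0// mulr_ge0.
Qed.

(* A closed bounded set is the decreasing intersection, over m, of the union of the
   cells of generation m that meet it. *)
Lemma measurable_closed_bounded A : 0 <= L -> A `<=` cube L ->
  (forall z, (forall e, 0 < e -> exists2 y, A y & edist z y < e) -> A z) ->
  measurable A.
Proof.
move=> L0 AL Acl.
rewrite (_ : A = cube L `&`
    \bigcap_m [set x | [set morton L m y | y in A] (morton L m x)]).
  apply: measurableI; first exact: measurable_cube.
  by apply: bigcap_measurable => [|m _]; [exists 0%N|exact: measurable_cells].
apply/seteqP; split=> [x Ax|x [cx Hx]].
  by split=> [|m _]; [exact: AL|exists x].
apply: Acl => e e0; have [m me] := exp2_small (d%:R * (2 * L)) e0.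
have [y Ay yx] := Hx m I; exists y => //; apply: le_lt_trans me.
by rewrite -mulrA; apply: edist_cell => //; exact: AL.
Qed.

Context (lam : {measure set (d.-tuple R) -> \bar R}).

Lemma measure_cells m A : measurable A ->
  lam A = (\sum_(n < nchild d ^ m) lam (A `&` cell m n))%E.
Proof.
move=> mA; rewrite -(@measure_semi_additive_ord _ _ _ lam _
  (fun n : 'I_(nchild d ^ m) => A `&` cell m n)).
- congr (lam _); rewrite -(bigcup_mkord _ (fun n => A `&` cell m n)).
  apply/seteqP; split=> [x Ax|x [n _ []]//].
  by exists (morton L m x) => //=; exact: morton_lt.
- by move=> n; apply: measurableI => //; exact: measurable_cell.
- by apply/trivIsetP => i j _ _ ij; apply/seteqP; split=> // x [[_ xi] [_ xj]];
    move: ij; rewrite -val_eqE/= -xi -xj eqxx.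
- by apply: bigsetU_measurable => n _; apply: measurableI => //; exact: measurable_cell.
Qed.

Hypothesis lamE : is_lebesgue_d lam.

Lemma lebesgue_box_corner (p : d.-tuple R) s : 0 <= s ->
  lam [set x | forall i, tnth p i <= tnth x i <= tnth p i + s] = (s ^+ d)%:E.
Proof.
move=> s0; have := @lamE p [tuple tnth p i + s | i < d].
rewrite (_ : \prod_(i < d) _ = s ^+ d); last first.
  under eq_bigr do rewrite tnth_mktuple addrC addKr.
  by rewrite prodr_const card_ord.
rewrite (_ : [set x | _] = [set x | forall i, tnth p i <= tnth x i <= tnth p i + s]).
  by apply=> i; rewrite tnth_mktuple lerDl.
by apply/seteqP; split=> x H i; have := H i; rewrite tnth_mktuple.
Qed.

Lemma measurable_box (p q : d.-tuple R) :
  measurable [set x | forall i, tnth p i <= tnth x i <= tnth q i].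
Proof.
rewrite (_ : [set x | _] =
    \bigcap_(i in [set: 'I_d]) [set x | tnth p i <= tnth x i <= tnth q i]).
  apply: fin_bigcap_measurable => // i _.
  have := @measurable_coord R d i measurableT `[tnth p i, tnth q i]%classic (measurable_itv _).
  by rewrite setTI set_itvcc.
by apply/seteqP; split=> x H i; [move=> _|]; exact: H.
Qed.

(* The preimage of a cell under a map expanding distances by [tau] lies in a box whose
   volume is comparable to that of the cell; summing over the cells meeting [A] gives a
   change of variables inequality that needs no invariance property of [lam]. *)
Lemma lebesgue_preimage_le m (tau : R) (h : d.-tuple R -> d.-tuple R) A B :
  0 < L -> 0 < tau -> measurable_fun setT h ->
  (forall x x', edist x x' = tau * edist (h x) (h x')) ->
  measurable A -> measurable B -> A `<=` cube L ->
  (forall x y, A x -> cube L y -> morton L m y = morton L m x -> B y) ->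
  (lam (h @^-1` A) <= (((4 * d%:R * tau) ^+ d)%:E * lam B))%E.
Proof.
move=> L0 tau0 mh hd mA mB AL AB.
have mhA C : measurable C -> measurable (h @^-1` C).
  by move=> mC; rewrite -[X in measurable X]setTI; exact: mh.
have mAc n : measurable (A `&` cell m n) by apply: measurableI => //; exact: measurable_cell.
have -> : lam (h @^-1` A) = (\sum_(n < nchild d ^ m) lam (h @^-1` (A `&` cell m n)))%E.
  rewrite -(@measure_semi_additive_ord _ _ _ lam _
    (fun n : 'I_(nchild d ^ m) => h @^-1` (A `&` cell m n))).
  - congr (lam _); rewrite -(bigcup_mkord _ (fun n => h @^-1` (A `&` cell m n))).
    apply/seteqP; split=> [x Ax|x [n _ []]//].
    by exists (morton L m (h x)) => //=; exact: morton_lt.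
  - by move=> n; exact: mhA.
  - by apply/trivIsetP => i j _ _ ij; apply/seteqP; split=> // x [[_ xi] [_ xj]];
      move: ij; rewrite -val_eqE/= -xi -xj eqxx.
  - by apply: bigsetU_measurable => n _; exact: mhA.
rewrite (measure_cells m mB) ge0_sume_distrr//; apply: lee_sum => n _.
have h0 : 0 <= L / 2 ^+ m by rewrite divr_ge0 ?exprn_ge0// ltW.
have [->|/set0P[x0 [Ax0 cx0]]] := eqVneq (h @^-1` (A `&` cell m n)) set0.
  by rewrite measure0 mule_ge0// lee_fin exprn_ge0// mulr_ge0// ltW.
have [p Hp] := morton_box m L0 (AL _ Ax0).
set r := tau * (d%:R * (2 * L / 2 ^+ m)).
have r0 : 0 <= r.
  by rewrite /r; apply: mulr_ge0; [exact: ltW|rewrite -mulrA; do 2 apply: mulr_ge0 => //].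
(* [r] bounds the diameter of the preimage of the cell, which therefore lies in the box of side
   [2 * r] centred at [x0]. *)
apply: (@le_trans _ _ ((2 * r) ^+ d)%:E).
  have r2 : 0 <= 2 * r by lra.
  rewrite -(@lebesgue_box_corner [tuple tnth x0 i - r | i < d])//.
  apply: le_measure; rewrite ?inE//; first exact: mhA.
    have := measurable_box [tuple tnth x0 i - r | i < d]
      [tuple tnth [tuple tnth x0 i - r | i < d] i + 2 * r | i < d].
    congr (measurable _); apply/seteqP.
    by split=> x H i; have := H i; rewrite !tnth_mktuple.
  move=> x [Ax cx] i; rewrite tnth_mktuple.
  have xr : edist x x0 <= r.
    rewrite hd ler_pM2l//; apply: edist_cell; rewrite ?ltW//; [exact: AL..|].
    by rewrite cx cx0.
  have := le_trans (coord_le_edist x x0 i) xr; rewrite ler_norml; lra.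
(* The last factor is the volume of the box that [morton_box] places inside the cell. *)
have -> : (2 * r) ^+ d = (4 * d%:R * tau) ^+ d * (L / 2 ^+ m) ^+ d.
  by rewrite -exprMn; congr (_ ^+ d); rewrite /r; ring.
rewrite EFinM lee_wpmul2l ?lee_fin ?exprn_ge0 ?mulr_ge0 ?(ltW tau0)//.
rewrite -(@lebesgue_box_corner p)//; apply: le_measure; rewrite ?inE.
- have := measurable_box p [tuple tnth p i + L / 2 ^+ m | i < d].
  congr (measurable _); apply/seteqP.
  by split=> x H i; have := H i; rewrite !tnth_mktuple.
- by apply: measurableI => //; exact: measurable_cell.
move=> x /Hp[cx mx]; split; last by rewrite /cell/= mx.
exact: (AB (h x0)).
Qed.

Lemma lebesgue_cube : 0 <= L -> lam (cube L) = ((2 * L) ^+ d)%:E.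
Proof.
move=> L0; rewrite -(@lebesgue_box_corner [tuple - L | i < d]) ?mulr_ge0//.
congr (lam _); apply/seteqP; split=> x H i; have := H i; rewrite !tnth_mktuple; lra.
Qed.

End Covering.

(** * Translations for which the moved set separates two nearby points *)

Section Separation.
Context (R : realType) (d : nat) (Om : set (d.-tuple R)) (a b beta c' : R).
Context (lam : {measure set (d.-tuple R) -> \bar R}).
Hypotheses (lamE : is_lebesgue_d lam) (bOm : ebounded Om).
Hypotheses (a0 : 0 < a) (ab : a < b) (beta0 : 0 < beta) (c'0 : 0 < c').
Hypothesis HOm : forall t : R, 0 < t -> t < 1 ->
  (lam (boundary_nbhd Om t) <= (c' * t `^ beta)%:E)%E.

(* The translations for which the moved set may separate [u] from a point at distance at
   most [t]. *)
Definition cutting M tau u t : set (d.-tuple R) :=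
  [set x | boundary_nbhd Om (t / a) (pull M tau x u)].

(** The points pulled back from [u] and [v] are at distance at most [t / a], and exactly one of them
    is in [Om]; the segment joining them meets the boundary. *)
Lemma separated_cutting M tau x u v t : M^T *m M = 1%:M -> a <= tau ->
  (edist u v <= t) -> ~ (moved x tau M Om u <-> moved x tau M Om v) ->
  cutting M tau u t x.
Proof.
move=> MM atau uv; have tau0 : 0 < tau := lt_le_trans a0 atau.
rewrite !moved_pull ?gt_eqF// => /segment_boundary[w Aw pw].
apply/boundary_nbhdP => e e0; exists w => //; apply: le_lt_trans pw _.
apply: (@le_lt_trans _ _ (t / a)); last by rewrite ltrDl.
rewrite ler_pdivlMr// mulrC; apply: le_trans uv.
rewrite -(@edist_pull_point _ _ M tau x u v)// ler_wpM2r// edist_ge0 //.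
Qed.

(** [lebesgue_preimage_le] reduces this to the volume of a neighbourhood of the boundary of [Om],
    its width [t / a] doubled to contain whole cells. The hypothesis on [Om] applies when
    [2 * (t / a) < 1]; otherwise the volume of the enclosing cube is a sufficient bound. *)
Lemma cutting_bound (T : R) : 0 < T -> exists2 C : R, 0 <= C &
  forall M tau u t, M^T *m M = 1%:M -> a <= tau -> tau <= b -> 0 < t -> t <= T ->
    measurable (cutting M tau u t) /\
    (lam (cutting M tau u t) <= (C * t `^ beta)%:E)%E.
Proof.
(* The added 1 leaves room for the doubled width, which is used only when it is below 1. *)
move=> T0; have b0 : 0 < b := lt_trans a0 ab; pose T' := T / a + 1.
have T'0 : 0 <= T' by rewrite /T' addr_ge0// divr_ge0// ltW.
have [L L0 HL] := boundary_nbhd_cube T'0 bOm.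
pose K := (4 * d%:R * b) ^+ d; pose V := (2 * L) ^+ d.
have K0 : 0 <= K by rewrite exprn_ge0// !mulr_ge0// ltW.
have V0 : 0 <= V by rewrite exprn_ge0// mulr_ge0// ltW.
pose C := K * (c' + V) * (2 / a) `^ beta.
have C0 : 0 <= C by rewrite !mulr_ge0 ?powR_ge0// addr_ge0// ltW.
exists C => // M tau u t MM atau taub t0 tT.
have tau0 : 0 < tau := lt_le_trans a0 atau.
have sT : t / a <= T' by rewrite /T' ler_wpDr// ler_pM2r ?invr_gt0.
have s0 : 0 < t / a by rewrite divr_gt0.
have mN s : s <= T' -> measurable (boundary_nbhd Om s).
  move=> sT'; apply: (@measurable_closed_bounded _ _ L); first exact: ltW.
    exact: HL.
  exact: boundary_nbhd_closed.
have mp := @measurable_pull_center R d M tau u.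
have pd x x' : edist x x' = tau * edist (pull M tau x u) (pull M tau x' u).
  by rewrite edist_pull_center.
split.
  by rewrite -[X in measurable X]setTI; apply: mp => //; exact: mN.
have main B m : measurable B -> (forall x y, boundary_nbhd Om (t / a) x -> cube L y ->
      morton L m y = morton L m x -> B y) ->
    (lam B <= ((c' + V) * (2 * (t / a)) `^ beta)%:E)%E ->
    (lam (cutting M tau u t) <= (C * t `^ beta)%:E)%E.
  move=> mB HB lB.
  apply: le_trans (lebesgue_preimage_le lamE L0 tau0 mp pd (mN _ sT) mB (HL _ sT) HB) _.
  apply: (@le_trans _ _ (K%:E * ((c' + V) * (2 * (t / a)) `^ beta)%:E)%E).
    apply: lee_pmul => //; rewrite ?lee_fin; first by rewrite exprn_ge0// !mulr_ge0// ltW.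
    rewrite /K lerXn2r ?nnegrE ?mulr_ge0// ?(ltW tau0) ?(ltW b0)//.
    by rewrite ler_wpM2l// mulr_ge0.
  rewrite -EFinM lee_fin /C (_ : 2 * (t / a) = (2 / a) * t); last by ring.
  rewrite powRM ?divr_ge0 ?(ltW a0) ?(ltW t0)//.
  by rewrite !mulrA.
have [s2|s2] := ltP (2 * (t / a)) 1.
  have [m Hm] := @exp2_small R (d%:R * (2 * L)) _ s0.
  apply: (main (boundary_nbhd Om (t / a + t / a)) m).
  - apply: mN; rewrite /T'; have : 0 <= T / a by rewrite divr_ge0 ?(ltW a0) ?(ltW T0).
    by lra.
  - move=> x y Nx cy e; apply: (boundary_nbhd_edist Nx).
    apply/ltW; apply: le_lt_trans Hm; rewrite -mulrA; apply: edist_cell => //; first exact: ltW.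
    exact: (HL _ sT).
  - rewrite (_ : t / a + t / a = 2 * (t / a)); last by ring.
    apply: le_trans (HOm _ s2) _; first by rewrite mulr_gt0.
    by rewrite lee_fin ler_wpM2r ?powR_ge0// lerDl.
apply: (main (cube L) 0%N); [exact: measurable_cube|by []|].
rewrite lebesgue_cube ?(ltW L0)// lee_fin -[leLHS]mulr1.
apply: ler_pM => //; first by rewrite lerDr ltW.
have := ge0_ler_powR (ltW beta0) _ _ s2; rewrite powR1; apply; rewrite nnegrE//.
by rewrite mulr_ge0// ltW.
Qed.

End Separation.

(** * Cutting an interval into unit pieces *)

Section Weights.
Context (R : realFieldType).
Implicit Types (s t : R) (i n N : nat) (P : nat -> R).

(** The length of the part of [i, i + 1] below [s]. *)
Definition clamp i s : R := Num.max 0 (Num.min 1 (s - i%:R)).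

Lemma clampP i s : [\/ s <= i%:R /\ clamp i s = 0,
  i%:R <= s <= i.+1%:R /\ clamp i s = s - i%:R | i.+1%:R <= s /\ clamp i s = 1].
Proof.
rewrite -natr1 /clamp; have [h|h] := leP s i%:R.
  by apply: Or31; rewrite min_r ?max_l//; lra.
have [h'|h'] := leP s (i%:R + 1); last by apply: Or33; rewrite min_l ?max_r//; lra.
by apply: Or32; rewrite min_r ?max_r//; lra.
Qed.

Lemma clamp_homo i : {homo clamp i : s t / s <= t}.
Proof.
move=> s t st; have i1 := natr1 (R := R) i.
by case: (clampP i s) => -[? ->]; case: (clampP i t) => -[? ->]; lra.
Qed.

Lemma clamp_le i s : s <= i%:R -> clamp i s = 0.
Proof. by have i1 := natr1 (R := R) i; case: (clampP i s) => -[? ->]; lra. Qed.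

Lemma clamp_ge i s : i.+1%:R <= s -> clamp i s = 1.
Proof. by have i1 := natr1 (R := R) i; case: (clampP i s) => -[? ->]; lra. Qed.

Lemma sum_clamp N s : 0 <= s <= N%:R -> \sum_(i < N) clamp i s = s.
Proof.
elim: N s => [|N IH] s; first by rewrite big_ord0; lra.
move=> s0; rewrite big_ord_recr/=; have [sN|sN] := leP s N%:R.
  by rewrite IH ?clamp_le ?addr0//; lra.
rewrite (eq_bigr (fun i : 'I_N => clamp i N%:R)) => [|i _].
  rewrite IH ?lexx ?ler0n//; have N1 := natr1 (R := R) N.
  by case: (clampP N s) => -[? ->]; lra.
have iN : i.+1%:R <= N%:R :> R by rewrite ler_nat.
by rewrite !clamp_ge// (le_trans iN)// ltW.
Qed.

(* The length of the intersection of [i, i + 1] and [P n, P (n + 1)]. *)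
Definition weight P i n := clamp i (P n.+1) - clamp i (P n).

Lemma weight_gt0 P i n : {homo P : a b / (a <= b)%N >-> a <= b} -> 0 < weight P i n ->
  i%:R < P n.+1 /\ P n < i.+1%:R.
Proof.
move=> Ph w0; have hh := clamp_homo i (Ph _ _ (leqnSn n)).
split; rewrite ltNge; apply/negP => h; move: w0; rewrite /weight.
  by rewrite !clamp_le ?subrr ?ltxx// (le_trans _ h)// Ph.
by rewrite !clamp_ge ?subrr ?ltxx// (le_trans h)// Ph.
Qed.

Lemma weight_ge0 P i n : {homo P : a b / (a <= b)%N >-> a <= b} -> 0 <= weight P i n.
Proof. by move=> Ph; rewrite subr_ge0; apply: clamp_homo; exact: Ph. Qed.

Lemma sum_weight_cells P N Q i : P 0%N = 0 -> P Q = N%:R -> (i < N)%N ->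
  \sum_(n < Q) weight P i n = 1.
Proof.
move=> P0 PQ iN; rewrite -(big_mkord xpredT (weight P i)) telescope_sumr//.
by rewrite P0 PQ clamp_ge ?ler_nat// clamp_le ?ler0n// subr0.
Qed.

Lemma sum_weight_pieces P N n : 0 <= P n <= N%:R -> 0 <= P n.+1 <= N%:R ->
  \sum_(i < N) weight P i n = P n.+1 - P n.
Proof. by move=> h h'; rewrite sumrB !sum_clamp. Qed.

End Weights.

(** * How many pieces are spread over several cubes of a generation *)

Section Levels.
Context (R : realFieldType) (D m N : nat) (P : nat -> R).
Hypotheses (D0 : (0 < D)%N) (Ph : {homo P : a b / (a <= b)%N >-> a <= b}).

(** The quotients by [D ^ (m - k)] number the ancestors of generation [k], so piece [i] charges
    cells in two different cubes of that generation. *)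
Definition straddles k (i : 'I_N) := [exists n : 'I_(D ^ m), exists n' : 'I_(D ^ m),
  [&& 0 < weight P i n, 0 < weight P i n' &
      (n %/ D ^ (m - k) < n' %/ D ^ (m - k))%N]].

(* A piece that straddles generation [k] contains a break point between two consecutive
   cells of generation [k], and distinct pieces contain distinct break points. *)
Lemma card_straddles k : (k <= m)%N -> (#|[set i | straddles k i]%SET| <= D ^ k)%N.
Proof.
move=> km; set q := (D ^ (m - k))%N; have q0 : (0 < q)%N by rewrite expn_gt0 D0.
have ex (i : 'I_N) : exists u : 'I_(D ^ k), straddles k i ->
    i%:R < P (u * q)%N < i.+1%:R.
  have Dk0 : (0 < D ^ k)%N by rewrite expn_gt0 D0.
  have [|nb] := boolP (straddles k i); last by exists (Ordinal Dk0).
  case/existsP=> n /existsP[n' /and3P[wn wn' nn']].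
  have uk : (n' %/ q < D ^ k)%N by rewrite ltn_divLR// -expnD subnKC.
  exists (Ordinal uk) => _ /=.
  have [h1 _] := weight_gt0 Ph wn; have [_ h2] := weight_gt0 Ph wn'.
  rewrite (lt_le_trans h1)/=; last by apply: Ph; rewrite -ltn_divLR.
  by rewrite (le_lt_trans _ h2)//; apply: Ph; exact: leq_divM.
have [f Hf] := choice ex.
rewrite -[leqRHS]card_ord; apply: (@leq_card_in _ _ f) => i j.
rewrite !inE => /Hf/andP[h1 h2] /Hf/andP[h3 h4] fij; move: h1 h2 h3 h4; rewrite fij.
move=> h1 h2 h3 h4; have := lt_trans h1 h4; have := lt_trans h3 h2.
rewrite !ltr_nat !ltnS => ji ij; apply/val_inj/eqP; by rewrite eqn_leq ji ij.
Qed.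

Lemma straddles0 i : ~~ straddles 0 i.
Proof.
apply/negP => /existsP[n /existsP[n' /and3P[_ _]]]; rewrite subn0.
by rewrite !divn_small.
Qed.

Lemma not_straddles k i (n n' : 'I_(D ^ m)) : ~~ straddles k i ->
  0 < weight P i n -> 0 < weight P i n' ->
  (n %/ D ^ (m - k) = n' %/ D ^ (m - k))%N.
Proof.
move=> /negP H wn wn'; apply/eqP; case: ltngtP => // h; case: H; apply/existsP.
  by exists n; apply/existsP; exists n'; rewrite wn wn' h.
by exists n'; apply/existsP; exists n; rewrite wn wn' h.
Qed.

(** [l] is the finest generation up to [k] that the piece does not straddle. If [l < k], generation
    [l + 1] is straddled and the term [j = l] of the sum equals [rho ^+ l]. *)
Lemma exists_level (rho : R) k i : 0 <= rho ->
  exists l, [/\ (l <= k)%N, ~~ straddles l i &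
    rho ^+ l <= rho ^+ k + \sum_(j < k) (straddles j.+1 i)%:R * rho ^+ j].
Proof.
move=> r0; elim: k => [|k [l [lk nb Hl]]].
  by exists 0%N; rewrite straddles0 big_ord0 addr0.
have S0 : 0 <= \sum_(j < k) (straddles j.+1 i)%:R * rho ^+ j.
  by apply: sumr_ge0 => j _; rewrite mulr_ge0// exprn_ge0.
have [bk|bk] := boolP (straddles k.+1 i); last first.
  by exists k.+1; rewrite big_ord_recr/= (negbTE bk) mul0r addr0 lerDl.
exists l; split; [exact: leqW|by []|].
rewrite big_ord_recr/= bk mul1r; have : 0 <= rho ^+ k.+1 by rewrite exprn_ge0.
by lra.
Qed.

Lemma sum_geometric_le (r : R) k : 2 <= r -> \sum_(j < k) r ^+ j <= r ^+ k.
Proof.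
move=> r2; elim: k => [|k IH]; first by rewrite big_ord0 expr0.
have rk : 0 <= r ^+ k by rewrite exprn_ge0//; lra.
rewrite big_ord_recr/= exprS; nra.
Qed.

(** Summing [exists_level] over the pieces, at most [D ^ j.+1] of them contribute [rho ^+ j]. The
    ratio [D%:R * rho] is at least 2, so the geometric sum is at most [(D%:R * rho) ^+ k], hence at
    most [N%:R * rho ^+ k]. *)
Lemma sum_level (rho : R) k : 0 <= rho -> 2 <= D%:R * rho -> (k <= m)%N ->
  (D ^ k <= N)%N -> exists l : 'I_N -> nat,
    (forall i, (l i <= m)%N /\ ~~ straddles (l i) i) /\
    \sum_i rho ^+ l i <= (1 + D%:R) * N%:R * rho ^+ k.
Proof.
move=> r0 Dr km kN.
have [l Hl] := choice (fun i => exists_level k i r0).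
exists l; split=> [i|]; first by have [lk nb _] := Hl i; split=> //; exact: leq_trans km.
apply: (@le_trans _ _ (\sum_(i < N) (rho ^+ k + \sum_(j < k) (straddles j.+1 i)%:R * rho ^+ j))).
  by apply: ler_sum => i _; have [] := Hl i.
rewrite big_split/= sumr_const card_ord -[X in X + _]mulr_natl mulrDl mul1r mulrDl.
apply: lerD => //; rewrite exchange_big/=.
apply: (@le_trans _ _ (\sum_(j < k) D%:R * (D%:R * rho) ^+ j)).
  apply: ler_sum => j _; rewrite -mulr_suml exprMn mulrA -exprS.
  rewrite ler_wpM2r ?exprn_ge0//.
  have -> : \sum_(i < N) (straddles j.+1 i)%:R = #|[set i | straddles j.+1 i]%SET|%:R :> R.
    by rewrite -sum1_card natr_sum [RHS]big_mkcond/=; apply: eq_bigr => i _; rewrite inE; case: ifP.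
  rewrite -natrX ler_nat; apply: card_straddles; exact: leq_trans (ltn_ord j) km.
rewrite -mulr_sumr -mulrA ler_wpM2l//; apply: le_trans (sum_geometric_le _ Dr) _.
by rewrite exprMn ler_wpM2r ?exprn_ge0// -natrX ler_nat.
Qed.

End Levels.

(** * Mean square of a sum of independent choices *)

Section IndependentChoice.
Context (R : realFieldType) (N Q : nat) (w : 'I_N -> 'I_Q -> R).
Hypotheses (w0 : forall i n, 0 <= w i n) (w1 : forall i, \sum_n w i n = 1).
Implicit Types (om : {ffun 'I_N -> 'I_Q}) (g f : 'I_N -> 'I_Q -> R).

(** The product law under which piece [i] picks cell [n] with probability [w i n], independently of
    the others. *)
Definition choice_weight om : R := \prod_i w i (om i).

Lemma choice_weight_ge0 om : 0 <= choice_weight om.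
Proof. by apply: prodr_ge0 => i _. Qed.

Lemma sum_choice_weight : \sum_om choice_weight om = 1.
Proof.
rewrite -(bigA_distr_bigA (fun i n => w i n))/=.
by rewrite big1// => i _; rewrite w1.
Qed.

Lemma prod_at (a : 'I_N) (c : R) : \prod_i (if i == a then c else 1) = c.
Proof. by rewrite -big_mkcond big_pred1_eq. Qed.

Lemma sum_choice_weight_pair (a b : 'I_N) g : (forall i, \sum_n w i n * g i n = 0) ->
  \sum_om choice_weight om * (g a (om a) * g b (om b)) =
  if a == b then \sum_n w a n * g a n ^+ 2 else 0.
Proof.
move=> g0.
(* Absorbing both factors into the product over [i] lets the expectation factor over the pieces. *)
pose h i n := w i n * (if i == a then g i n else 1) * (if i == b then g i n else 1).
rewrite (eq_bigr (fun om => \prod_i h i (om i))); last first.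
  move=> om _; rewrite /h !big_split/= -mulrA; congr (_ * (_ * _)).
    by rewrite -[LHS](prod_at a); apply: eq_bigr => i _; case: eqP => // ->.
  by rewrite -[LHS](prod_at b); apply: eq_bigr => i _; case: eqP => // ->.
rewrite -(bigA_distr_bigA h)/= (bigD1 a)//= {1}/h eqxx.
have [ab|ab] := eqVneq a b.
  subst b.
  rewrite [X in _ * X]big1 ?mulr1/=.
    by apply: eq_bigr => n _; rewrite -mulrA -expr2.
  move=> i /negbTE ia; rewrite -(w1 i); apply: eq_bigr => n _.
  by rewrite /h ia !mulr1.
by under eq_bigr do rewrite mulr1; rewrite g0 mul0r.
Qed.

Lemma sum_choice_weight_sqr g : (forall i, \sum_n w i n * g i n = 0) ->
  \sum_om choice_weight om * (\sum_i g i (om i)) ^+ 2 = \sum_i \sum_n w i n * g i n ^+ 2.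
Proof.
move=> g0.
transitivity (\sum_a \sum_b \sum_om choice_weight om * (g a (om a) * g b (om b))).
  rewrite [RHS](eq_bigr _ (fun a _ => exchange_big _ _ _ _ _ _)) /= exchange_big/=.
  apply: eq_bigr => om _; rewrite expr2 mulr_suml mulr_sumr; apply: eq_bigr => a _.
  by rewrite !mulr_sumr.
apply: eq_bigr => a _; rewrite (bigD1 a)//= sum_choice_weight_pair// eqxx.
by rewrite [X in _ + X]big1 ?addr0// => b ba; rewrite sum_choice_weight_pair// eq_sym (negbTE ba).
Qed.

(** The error splits into a centred part and a bias [B]. By independence the first has the sum of
    the variances as its mean square: 0 for a piece on which [f] is constant, at most 1 for the
    others. Only the pairs marked by [kap] contribute to the bias. *)
Lemma mean_square_le f (q : 'I_Q -> R) (chi : 'I_N -> bool) (kap : 'I_N -> 'I_Q -> bool) :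
  (forall i n, 0 <= f i n <= 1) -> (forall n, 0 <= q n <= 1) ->
  (forall i n n', ~~ chi i -> 0 < w i n -> 0 < w i n' -> f i n = f i n') ->
  (forall i n, ~~ kap i n -> 0 < w i n -> f i n = q n) ->
  \sum_om choice_weight om * (\sum_i f i (om i) - \sum_i \sum_n w i n * q n) ^+ 2 <=
  2 * \sum_i (chi i)%:R + 2 * N%:R * \sum_i \sum_n w i n * (kap i n)%:R.
Proof.
move=> f01 q01 Hchi Hkap.
pose e i := \sum_n w i n * f i n.
pose B := \sum_i (e i - \sum_n w i n * q n).
have g0 i : \sum_n w i n * (f i n - e i) = 0.
  by under eq_bigr do rewrite mulrBr; rewrite sumrB -mulr_suml w1 mul1r subrr.
have e01 i : 0 <= e i <= 1.
  rewrite sumr_ge0/= => [|n _]; last by rewrite mulr_ge0//; have /andP[] := f01 i n.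
  rewrite -(w1 i); apply: ler_sum => n _; rewrite ler_piMr//.
  by have /andP[] := f01 i n.
have sqr_le (A C : R) : (A + C) ^+ 2 <= 2 * A ^+ 2 + 2 * C ^+ 2.
  by have := sqr_ge0 (A - C); rewrite !expr2; nra.
apply: (@le_trans _ _ (\sum_om (choice_weight om *
   (2 * (\sum_i (f i (om i) - e i)) ^+ 2) + choice_weight om * (2 * B ^+ 2)))).
  apply: ler_sum => om _; rewrite -mulrDr ler_wpM2l ?choice_weight_ge0//.
  apply: le_trans (sqr_le _ _); rewrite le_eqVlt; apply/orP; left; apply/eqP.
  congr (_ ^+ 2); rewrite /B !sumrB; ring.
rewrite big_split/= -mulr_suml sum_choice_weight mul1r -mulrA; apply: lerD.
  under eq_bigr do rewrite mulrCA; rewrite -mulr_sumr ler_pM2l//.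
  rewrite (@sum_choice_weight_sqr (fun i n => f i n - e i))//; apply: ler_sum => i _.
  have [_|nchi] := boolP (chi i).
    rewrite -(w1 i); apply: ler_sum => n _; rewrite ler_piMr//.
    by have := f01 i n; have := e01 i; rewrite expr2; nra.
  rewrite big1// => n _; have := w0 i n.
  rewrite le_eqVlt => /orP[/eqP <-|wn]; first by rewrite mul0r.
  suff -> : e i = f i n by rewrite subrr expr0n mulr0.
  rewrite /e -[RHS]mul1r -(w1 i) mulr_suml; apply: eq_bigr => n' _.
  have := w0 i n'; rewrite le_eqVlt => /orP[/eqP <-|wn']; first by rewrite !mul0r.
  by rewrite (Hchi i n n').
rewrite ler_pM2l//.
pose K := \sum_i \sum_n w i n * (kap i n)%:R.
have K0 : 0 <= K by apply: sumr_ge0 => i _; apply: sumr_ge0 => n _; rewrite mulr_ge0.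
have BK : `|B| <= K.
  apply: le_trans (ler_norm_sum _ _ _) _; apply: ler_sum => i _.
  rewrite -sumrB; apply: le_trans (ler_norm_sum _ _ _) _; apply: ler_sum => n _.
  rewrite -mulrBr normrM ger0_norm//.
  have := w0 i n; rewrite le_eqVlt => /orP[/eqP <-|wn]; first by rewrite !mul0r.
  rewrite ler_pM2l//; have [_|nk] := boolP (kap i n).
    by rewrite ler_norml /=; have := f01 i n; have := q01 n; lra.
  by rewrite (Hkap _ _ nk wn) subrr normr0.
have KN : K <= N%:R.
  rewrite -[leRHS](_ : \sum_(i < N) 1 = _); last by rewrite sumr_const card_ord.
  apply: ler_sum => i _; rewrite -[leRHS](w1 i); apply: ler_sum => n _.
  by rewrite ler_piMr//; case: (kap i n); rewrite ?ler01.
(* Of the two factors [|B|], one is bounded by [N%:R] and the other by [K]. *)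
rewrite -real_normK ?num_real// expr2; apply: ler_pM => //; exact: le_trans KN.
Qed.

End IndependentChoice.

(** * Distinct points in sets of positive measure *)

Section Points.
Context (R : realType) (d : nat) (lam : {measure set (d.-tuple R) -> \bar R}).
Hypotheses (d0 : (0 < d)%N) (lamE : is_lebesgue_d lam).

Lemma point_box (x : d.-tuple R) :
  [set x] = [set y | forall i, tnth x i <= tnth y i <= tnth x i].
Proof.
apply/seteqP; split=> [y -> i|y H]; first by rewrite lexx.
by apply: eq_from_tnth => i; apply/eqP; rewrite eq_le andbC; exact: H.
Qed.

Lemma measurable_point (x : d.-tuple R) : measurable [set x].
Proof. by rewrite point_box; exact: measurable_box. Qed.

Lemma lebesgue_point (x : d.-tuple R) : lam [set x] = 0%E.
Proof.
rewrite point_box lamE => [|i]; last exact: lexx.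
by case: d d0 x => // n _ x; rewrite big_ord_recl subrr mul0r.
Qed.

Lemma lebesgue_seq (s : seq (d.-tuple R)) : measurable [set` s] /\ lam [set` s] = 0%E.
Proof.
elim: s => [|x s [ms ls]]; first by rewrite set_nil measure0.
have -> : [set` x :: s] = [set x] `|` [set` s].
  apply/seteqP; split=> y /=; rewrite inE.
    by move=> /orP[/eqP ->|ys]; [left|right].
  by move=> [->|->]; rewrite ?eqxx ?orbT.
have mx := measurable_point x; split; first exact: measurableU.
by rewrite measureU0//; exact: lebesgue_point.
Qed.

(** A finite set is null and cannot contain [A], so a new point of [A] can always be added. *)
Lemma distinct_points (A : set (d.-tuple R)) N : measurable A -> (0 < lam A)%E ->
  exists r : 'I_N -> d.-tuple R, injective r /\ forall i, A (r i).
Proof.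
move=> mA A0; suff [s [sN us sA]] : exists s : seq (d.-tuple R),
    [/\ size s = N, uniq s & [set` s] `<=` A].
  exists (fun i => nth [tuple 0 | _ < d] s i); split=> [i j /eqP|i].
    by rewrite nth_uniq ?sN// => /eqP/val_inj.
  by apply: sA => /=; rewrite mem_nth ?sN.
elim: N => [|N [s [sN us sA]]]; first by exists [::]; split=> //; rewrite set_nil.
have [ms ls] := lebesgue_seq s.
have [As|/existsNP[x /not_implyP[Ax xs]]] := pselect (A `<=` [set` s]).
  by move: A0; rewrite (subset_measure0 mA ms As ls) ltxx.
exists (x :: s); split=> /=; [by rewrite sN|by rewrite us andbT; apply/negP|].
by move=> y /=; rewrite inE => /orP[/eqP -> //|ys]; exact: sA.
Qed.

End Points.

(** * Measurability of the rotation group, given by polynomial equations in the entries *)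

Section SO.
Context (R : realType) (d : nat).

Lemma measurable_mx_entry (i j : 'I_d) :
  measurable_fun setT (fun m : d.-tuple (d.-tuple R) => mx_of m i j).
Proof.
rewrite (_ : (fun m => _) = (fun v : d.-tuple R => tnth v j) \o
    (fun m : d.-tuple (d.-tuple R) => tnth m i)).
  by apply: measurableT_comp; exact: measurable_tnth.
by apply/funext => m; rewrite mxE.
Qed.

Lemma measurable_eq_cst (d' : measure_display) (T : measurableType d') (f : T -> R) (r : R) :
  measurable_fun setT f -> measurable [set t | f t = r].
Proof.
by move=> mf; have := mf measurableT [set r] (measurable_set1 r); rewrite setTI.
Qed.

Lemma measurable_SOd : measurable [set m : d.-tuple (d.-tuple R) | SOd (mx_of m)].
Proof.
pose S i j := [set m : d.-tuple (d.-tuple R) | \sum_k mx_of m k i * mx_of m k j = (i == j)%:R].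
pose Dt := [set m : d.-tuple (d.-tuple R) | \det (mx_of m) = 1].
rewrite (_ : [set m | _] = (\bigcap_(i in [set: 'I_d]) \bigcap_(j in [set: 'I_d]) S i j) `&` Dt).
  apply: measurableI.
    apply: fin_bigcap_measurable => // i _; apply: fin_bigcap_measurable => // j _.
    apply: measurable_eq_cst; apply: measurable_sum => k.
    by apply: measurable_funM; exact: measurable_mx_entry.
  apply: measurable_eq_cst; apply: measurable_sum => s.
  apply: measurable_funM => //; apply: measurable_prod => i _; exact: measurable_mx_entry.
apply/seteqP; split=> m [] H D1; split=> //.
  move=> i _ j _; rewrite /S /=; have /matrixP/(_ i j) := H; rewrite !mxE => <-.
  by apply: eq_bigr => k _; rewrite !mxE.
apply/matrixP => i j; rewrite [RHS]mxE -(H i I j I) mxE.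
by apply: eq_bigr => k _; rewrite !mxE.
Qed.

End SO.

(** By superadditivity, applied to each of the two integrals, the average of the iterated integrals
    is at most the iterated integral of the average. Some index does no worse than the average. [Z]
    is meant for the matrices that are not rotations. *)
Lemma exists_le_average (R : realType) d (T : measurableType d) (nu : probability T R)
    (I : finType) (p : I -> R) (F : I -> R -> T -> \bar R) (Z : set T) (a b B : R) :
  (forall i, 0 <= p i) -> \sum_i p i = 1 -> a < b -> 0 <= B ->
  (forall i tau M, 0 <= F i tau M)%E -> measurable Z -> nu Z = 0%E ->
  (forall tau M, a <= tau <= b -> ~ Z M -> (\sum_i (p i)%:E * F i tau M <= B%:E)%E) ->
  exists i, 0 < p i /\
    (\int[lebesgue_measure]_(tau in `[a, b]) \int[nu]_(M in setT) F i tau M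
       <= (B * (b - a))%:E)%E.
Proof.
move=> p0 p1 ab B0 F0 mZ Z0 FB.
pose J i := (\int[lebesgue_measure]_(tau in `[a, b]) \int[nu]_(M in setT) F i tau M)%E.
have JB : (\sum_i (p i)%:E * J i <= (B * (b - a))%:E)%E.
  apply: le_trans.
    apply: (@lower_integral_sum _ _ R lebesgue_measure _ _ _ p
      (fun i tau => \int[nu]_(M in setT) F i tau M)%E) => //.
    by move=> i tau _; exact: integral_ge0.
  have lab : lebesgue_measure `[a, b] = (b - a)%:E.
    by rewrite lebesgue_measure_itv/= lte_fin ab EFinB.
  rewrite EFinM -lab; apply: lower_integral_le_cst => //.
    move=> tau _; apply: sume_ge0 => i _; rewrite mule_ge0 ?lee_fin//.
    exact: integral_ge0.
  move=> tau; rewrite /= in_itv/= => taub.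
  apply: le_trans; first by apply: (@lower_integral_sum _ _ R nu _ _ _ p (fun i => F i tau)).
  rewrite -[leRHS]mule1 -(@probability_setT _ _ _ nu).
  apply: (@lower_integral_le_ae _ _ _ _ _ B Z) => // [M|M ZM].
    by apply: sume_ge0 => i _; rewrite mule_ge0 ?lee_fin.
  exact: FB.
have [i0 pi0] : exists i, 0 < p i.
  apply: contrapT => /forallNP H; have : \sum_i p i = 0.
    by apply: big1 => i _; apply/eqP; rewrite eq_le p0 leNgt andbT; apply/negP.
  by rewrite p1 => /eqP; rewrite oner_eq0.
(* The minimum is taken over indices of positive weight, since only such a choice is known to give
   distinct points of [E]. *)
have [i pi Ji] := @Order.TotalTheory.arg_minP _ _ _ i0 (fun i => 0 < p i) J pi0.
exists i; split=> //; apply: le_trans JB.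
rewrite -[leLHS]mul1e -p1 -sumEFin ge0_sume_distrl//; last by move=> j _; rewrite lee_fin.
apply: lee_sum => j _; have := p0 j; rewrite le_eqVlt => /orP[/eqP <-|pj].
  by rewrite !mul0e.
by rewrite lee_pmul2l//; exact: Ji.
Qed.

(** * The random points and the mean square of their discrepancy *)

Section Sampling.
Context (R : realType) (d : nat) (lam : {measure set (d.-tuple R) -> \bar R}).
Context (E : set (d.-tuple R)) (L : R) (m N : nat).
Hypotheses (d0 : (0 < d)%N) (lamE : is_lebesgue_d lam) (L0 : 0 < L).
Hypotheses (mE : measurable E) (EL : E `<=` cube L) (E0 : (0 < lam E)%E).

Let Q := (nchild d ^ m)%N.
Let vol (A : set (d.-tuple R)) : R := fine (lam (E `&` A)).

Lemma measure_sub_fin (A : set (d.-tuple R)) : measurable A -> lam (E `&` A) \is a fin_num.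
Proof.
move=> mA; rewrite ge0_fin_numE//; apply: (@le_lt_trans _ _ (lam (cube L))).
  apply: le_measure; rewrite ?inE//; [exact: measurableI|exact: measurable_cube|].
  by move=> x [/EL].
by rewrite lebesgue_cube ?ltry// ltW.
Qed.

Lemma fine_measure_gt0 : 0 < fine (lam E).
Proof.
have := measure_sub_fin measurableT; rewrite setIT => fE.
by rewrite -lte_fin fineK.
Qed.

Lemma vol_ge0 A : 0 <= vol A.
Proof. exact: fine_ge0. Qed.

Lemma vol_le A B : measurable A -> measurable B -> A `<=` B -> vol A <= vol B.
Proof.
move=> mA mB AB; rewrite fine_le ?measure_sub_fin//.
apply: le_measure; rewrite ?inE//; [exact: measurableI|exact: measurableI|].
by move=> x [Ex Ax]; split=> //; exact: AB.
Qed.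

Lemma vol_cells F : measurable F -> vol F = \sum_(n < Q) vol (F `&` cell L m n).
Proof.
move=> mF; rewrite /vol (measure_cells L lam m (measurableI _ _ mE mF)).
rewrite -sum_fine => [|n _]; first by apply: eq_bigr => n _; rewrite setIA.
by rewrite -setIA measure_sub_fin//; apply: measurableI => //; exact: measurable_cell.
Qed.

(** The mass of [E] in the first [n] cells of the Morton order, scaled to a total of [N]; piece [i]
    corresponds to the values in [i, i + 1]. *)
Definition cumul n : R := \sum_(j < n) N%:R * (vol (cell L m j) / fine (lam E)).

Lemma cumul_homo : {homo cumul : a b / (a <= b)%N >-> a <= b}.
Proof.
apply: homo_leq => [//|x y z|n]; first exact: le_trans.
by rewrite /cumul big_ord_recr/= lerDl mulr_ge0// divr_ge0 ?vol_ge0 ?(ltW fine_measure_gt0).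
Qed.

Lemma cumul0 : cumul 0 = 0.
Proof. by rewrite /cumul big_ord0. Qed.

Lemma cumul_all : cumul Q = N%:R.
Proof.
rewrite /cumul -mulr_sumr -mulr_suml.
rewrite (eq_bigr (fun n : 'I_Q => vol (setT `&` cell L m n))) => [|n _]; last by rewrite setTI.
by rewrite -vol_cells// /vol setIT divff ?mulr1// gt_eqF// fine_measure_gt0.
Qed.

Lemma cumul_bound n : (n <= Q)%N -> 0 <= cumul n <= N%:R.
Proof.
by move=> nQ; rewrite -cumul_all -{1}cumul0 !cumul_homo.
Qed.

Local Notation w := (fun (i : 'I_N) (n : 'I_Q) => weight cumul i n).

Lemma weight_vol_gt0 i n : 0 < weight cumul i n -> 0 < vol (cell L m n).
Proof.
move=> w0; rewrite lt_neqAle vol_ge0 andbT eq_sym; apply: contraTneq w0 => v0.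
by rewrite /weight /cumul big_ord_recr/= v0 mul0r mulr0 addr0 subrr ltxx.
Qed.

Lemma weight_sum (i : 'I_N) : \sum_n w i n = 1.
Proof. by rewrite (@sum_weight_cells _ _ N) ?cumul0 ?cumul_all. Qed.

(* This is 0 on a null cell, where the denominator vanishes. *)
Definition cell_prob (F : set (d.-tuple R)) n : R :=
  vol (F `&` cell L m n) / vol (cell L m n).

Lemma cell_prob_bound F n : measurable F -> 0 <= cell_prob F n <= 1.
Proof.
move=> mF; have mc := @measurable_cell R d L m n.
rewrite divr_ge0 ?vol_ge0//=; have := vol_ge0 (cell L m n).
rewrite le_eqVlt => /orP[/eqP v0|v0]; first by rewrite /cell_prob -v0 invr0 mulr0.
by rewrite ler_pdivrMr// mul1r vol_le//; exact: measurableI.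
Qed.

(** The weights of a cell, summed over the pieces, give [N] times its share of the mass of [E],
    which cancels the denominator of [cell_prob]. Points uniform in their cells would thus be
    unbiased. *)
Lemma weight_cell_prob F : measurable F ->
  \sum_i \sum_n w i n * cell_prob F n = N%:R * mu_E lam E F.
Proof.
move=> mF; rewrite exchange_big/= /mu_E -[fine (lam (E `&` F))]/(vol F) vol_cells//.
rewrite mulr_suml mulr_sumr; apply: eq_bigr => n _.
rewrite -mulr_suml sum_weight_pieces ?cumul_bound// ?(ltnW (ltn_ord n))//.
rewrite /cumul big_ord_recr/= addrAC subrr add0r -mulrA; congr (_ * _).
have mc := @measurable_cell R d L m n.
rewrite /cell_prob; have := vol_ge0 (cell L m n); have := fine_measure_gt0.
have : vol (F `&` cell L m n) <= vol (cell L m n) by rewrite vol_le//; exact: measurableI.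
have := vol_ge0 (F `&` cell L m n).
move: (vol (F `&` _)) (vol (cell _ _ _)) (fine _) => x v e x0 xv e0.
rewrite le_eqVlt => /orP[/eqP v0|v0].
  by rewrite -v0 invr0 !mulr0 (_ : x = 0) ?mul0r//; apply/eqP; rewrite eq_le x0 v0 xv.
by field; rewrite !gt_eqF.
Qed.

(** Each cell gets one representative per piece, so that pieces sharing a cell still receive
    distinct points. *)
Lemma exists_representatives : exists r : 'I_N -> 'I_Q -> d.-tuple R,
  forall n : 'I_Q, 0 < vol (cell L m n) ->
    injective (r^~ n) /\ forall i, E (r i n) /\ cell L m n (r i n).
Proof.
have H (n : 'I_Q) : exists s : 'I_N -> d.-tuple R, 0 < vol (cell L m n) ->
    injective s /\ forall i, E (s i) /\ cell L m n (s i).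
  have [v0|v0] := ltP 0 (vol (cell L m n)); last by exists (fun=> [tuple 0 | i < d]).
  have mc := @measurable_cell R d L m n.
  have [||s [sinj sE]] := @distinct_points _ _ _ d0 lamE (E `&` cell L m n) N.
  - exact: measurableI.
  - by rewrite -(fineK (measure_sub_fin mc)) lte_fin.
  by exists s.
have [s Hs] := choice H; exists (fun i n => s n i) => n vn; exact: Hs.
Qed.

Lemma choice_weight_gt0 (om : {ffun 'I_N -> 'I_Q}) (i : 'I_N) :
  0 < choice_weight w om -> 0 < weight cumul i (om i).
Proof.
move=> p0; rewrite lt_neqAle weight_ge0 ?andbT; last exact: cumul_homo.
apply: contraTneq p0 => e; rewrite /choice_weight (bigD1 i)//= -e mul0r ltxx //.
Qed.

Context (Om : set (d.-tuple R)) (a : R).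
Hypotheses (a0 : 0 < a) (mOm : measurable Om).

(** [mean_square_le] is applied to the indicator of [moved x tau M Om] at the representatives. The
    variance is tested at the scale of generation [l i], where piece [i] lies in a single cube, and
    the bias at the scale of generation [m]. *)
Lemma sampling (l : 'I_N -> nat) :
  (forall i, (l i <= m)%N /\ ~~ straddles (nchild d) m cumul (l i) i) ->
  exists (r : 'I_N -> 'I_Q -> d.-tuple R) (u : 'I_N -> d.-tuple R),
  (forall om : {ffun 'I_N -> 'I_Q}, 0 < choice_weight w om ->
    injective (fun i => r i (om i)) /\ forall i, E (r i (om i))) /\
  forall M tau x, M^T *m M = 1%:M -> a <= tau ->
    \sum_om choice_weight w om *
      discrepancy lam E (fun i => r i (om i)) (moved x tau M Om) ^+ 2 <=
    2 * \sum_i \1_(cutting Om a M tau (u i) (d%:R * (2 * L / 2 ^+ l i))) x +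
    2 * N%:R * \sum_i \sum_n w i n *
        \1_(cutting Om a M tau (r i n) (d%:R * (2 * L / 2 ^+ m))) x.
Proof.
move=> Hl; have [r Hr] := exists_representatives.
have rw (i : 'I_N) (n : 'I_Q) : 0 < w i n ->
    [/\ injective (r^~ n), E (r i n) & morton L m (r i n) = n].
  by move=> /weight_vol_gt0/Hr[rinj /(_ i)[Er cr]].
have exn (i : 'I_N) : exists n : 'I_Q, 0 < w i n.
  apply: contrapT => /forallNP H; have := weight_sum i; rewrite big1 => [/eqP|n _].
    by rewrite eq_sym oner_eq0.
  apply/eqP; rewrite eq_le weight_ge0 ?andbT; last exact: cumul_homo.
  by rewrite leNgt; apply/negP.
have [nu Hnu] := choice exn.
exists r, (fun i => r i (nu i)); split=> [om p0|M tau x MM atau].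
  have rom i := rw i (om i) (choice_weight_gt0 i p0).
  split=> [i j rij|i]; last by have [] := rom i.
  have [rinj _ ri] := rom i; have [_ _ rj] := rom j.
  have omij : om i = om j by apply/val_inj; rewrite /= -ri -rj rij.
  by apply: rinj; rewrite rij omij.
set F := moved x tau M Om.
have tau0 : 0 < tau := lt_le_trans a0 atau.
have mF : measurable F by apply: measurable_moved => //; rewrite gt_eqF.
pose f i n : R := (`[< F (r i n) >])%:R.
pose chi i := x \in cutting Om a M tau (r i (nu i)) (d%:R * (2 * L / 2 ^+ l i)).
pose kap i n := x \in cutting Om a M tau (r i n) (d%:R * (2 * L / 2 ^+ m)).
have asboolE (y z : d.-tuple R) : ~ ~ (F y <-> F z) -> `[< F y >] = `[< F z >].
  by move=> /contrapT; exact: asbool_equiv_eq.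
(* The representatives of piece [i] share a cube of generation [l i]; off the cutting set of one of
   them, none is separated from it. *)
have fchi (i : 'I_N) (n : 'I_Q) : ~~ chi i -> 0 < w i n -> f i n = f i (nu i).
  move=> nchi wn; congr (_%:R); congr nat_of_bool; apply/esym/asboolE => H.
  move/negP: nchi; apply; rewrite inE; apply: (separated_cutting a0 MM atau _ H).
  have [_ En cn] := rw i n wn; have [_ En' cn'] := rw i (nu i) (Hnu i).
  apply: edist_cell; [exact: ltW|exact: EL|exact: EL|].
  have [lm nb] := Hl i; rewrite -!(morton_ancestor _ _ lm) cn cn'.
  exact: (not_straddles nb (Hnu i) wn).
(* Here [F] contains or misses the whole part of [E] in the cell, so [cell_prob] is 1 or 0, as is
   the indicator. *)
have fkap (i : 'I_N) (n : 'I_Q) : ~~ kap i n -> 0 < w i n -> f i n = cell_prob F n.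
  move=> nkap wn; have [_ En cn] := rw i n wn.
  have v0 := weight_vol_gt0 wn; have mc := @measurable_cell R d L m n.
  have same y : E y -> cell L m n y -> F y <-> F (r i n).
    move=> Ey cy; apply: contrapT => H; move/negP: nkap; apply; rewrite inE.
    apply: (separated_cutting (v := y) a0 MM atau) => [|H']; last by apply: H; apply: iff_sym.
    by apply: edist_cell; [exact: ltW|exact: EL|exact: EL|rewrite cn cy].
  have [Fr|Fr] := pselect (F (r i n)).
    rewrite /f asboolT// /cell_prob (_ : vol (F `&` _) = vol (cell L m n)) ?divff ?gt_eqF//.
    congr fine; congr (lam _); apply/seteqP; split=> y [Ey]; first by move=> [].
    by move=> cy; split=> //; split=> //; apply/same.
  rewrite /f asboolF// /cell_prob (_ : vol (F `&` _) = 0) ?mul0r//.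
  rewrite /vol (_ : _ `&` _ = set0) ?measure0//; apply/seteqP; split=> // y [Ey [Fy cy]].
  by apply: Fr; apply/(same y).
have f01 (i : 'I_N) (n : 'I_Q) : 0 <= f i n <= 1.
  by rewrite /f; case: `[< _ >]; rewrite ?lexx ?ler01.
have fchi2 (i : 'I_N) (n n' : 'I_Q) : ~~ chi i -> 0 < w i n -> 0 < w i n' -> f i n = f i n'.
  by move=> nc wn wn'; rewrite !fchi.
have := mean_square_le (fun i n => weight_ge0 _ _ cumul_homo) weight_sum
  f01 (fun n => cell_prob_bound n mF) fchi2 fkap.
rewrite weight_cell_prob// => H.
apply: le_trans (_ : _ <= 2 * \sum_i (chi i)%:R +
  2 * N%:R * \sum_i \sum_n w i n * (kap i n)%:R) _; last exact: lexx.
apply: le_trans H; rewrite le_eqVlt; apply/orP; left; apply/eqP.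
apply: eq_bigr => om _; congr (_ * (_ - _) ^+ 2).
rewrite -sum1_card natr_sum big_mkcond/=; apply: eq_bigr => i _.
by rewrite /f unfold_in /in_set /mkset asboolb; case: `[< _ >].
Qed.

End Sampling.

(** * Estimates with real powers *)

Section Numbers.
Context (R : realType).
Implicit Types (x r beta C : R).

Lemma powRX x r n : 0 <= x -> (x ^+ n) `^ r = (x `^ r) ^+ n.
Proof.
move=> x0; elim: n => [|n IH]; first by rewrite !expr0 powR1.
by rewrite !exprS powRM ?exprn_ge0// IH.
Qed.

Lemma half_powR_small beta C : 0 < beta -> 0 <= C ->
  exists j, C * (2^-1 `^ beta) ^+ j <= 1.
Proof.
move=> b0 C0; have C1 : 0 < C + 1 by lra.
have e0 : 0 < ((C + 1)^-1) `^ beta^-1 by rewrite powR_gt0// invr_gt0.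
have [j] := exp2_small 1 e0; rewrite div1r => Hj; exists j.
have h : 0 <= (2 ^+ j)^-1 :> R by rewrite invr_ge0 exprn_ge0.
have := ge0_ler_powR (ltW b0) _ _ (ltW Hj); rewrite !nnegrE h powR_ge0 => /(_ isT isT).
rewrite -powRrM mulVf ?gt_eqF// powRr1 ?invr_ge0 ?(ltW C1)//.
rewrite -exprVn powRX ?invr_ge0// => H.
apply: le_trans (_ : C * (C + 1)^-1 <= 1); first by rewrite ler_wpM2l.
by rewrite ler_pdivrMr// mul1r lerDl.
Qed.

Lemma half_powR_scale beta d k N : (0 < d)%N -> 0 < beta -> (0 < N)%N ->
  (N <= (2 ^ d) ^ k.+1)%N ->
  N%:R * (2^-1 `^ beta) ^+ k <= (2^-1 `^ beta)^-1 * N%:R `^ (1 - beta / d%:R).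
Proof.
move=> d0 b0 N0 Nk; set rho := 2^-1 `^ beta.
have rho0 : 0 < rho by rewrite powR_gt0// invr_gt0.
have dR : d%:R != 0 :> R by rewrite pnatr_eq0 -lt0n.
have bd : 0 <= beta / d%:R by rewrite divr_ge0// ltW.
have NR : N%:R != 0 :> R by rewrite pnatr_eq0 -lt0n.
pose y : R := 2 ^+ k.+1; have y0 : 0 < y by rewrite exprn_gt0.
have Ny : N%:R `^ (beta / d%:R) <= y `^ beta.
  apply: (@le_trans _ _ ((y ^+ d) `^ (beta / d%:R))).
    apply: ge0_ler_powR; rewrite ?nnegrE ?exprn_ge0//.
    rewrite /y -!natrX ler_nat; apply: leq_trans Nk _.
    by rewrite -!expnM mulnC.
  by rewrite -powR_mulrn ?(ltW y0)// -powRrM mulrCA divff// mulr1.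
have ry : rho ^+ k.+1 * y `^ beta = 1.
  rewrite -powRX ?invr_ge0// -powRM ?exprn_ge0 ?invr_ge0//.
  by rewrite /y -exprMn mulVf// expr1n powR1.
have H : rho ^+ k.+1 * N%:R `^ (beta / d%:R) <= 1.
  by rewrite -[leRHS]ry ler_wpM2l ?exprn_ge0 ?(ltW rho0).
have NN : N%:R = N%:R `^ (1 - beta / d%:R) * N%:R `^ (beta / d%:R) :> R.
  by rewrite -powRD ?NR ?implybT// subrK powRr1.
rewrite -(ler_pM2l rho0) mulVKf ?gt_eqF// mulrCA -exprS {1}NN.
by rewrite -mulrA [_ * rho ^+ _]mulrC ler_piMr// powR_ge0.
Qed.

(** [S] stands for the sum of the [rho ^+ l i], [rk] and [rm] for [rho ^+ k] and [rho ^+ m]. *)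
Lemma variance_bias_le (C G D n rk rm S : R) : 0 <= C -> 0 <= G -> 0 <= n ->
  S <= (1 + D) * n * rk -> n * rm <= rk ->
  2 * (C * (G * S)) + 2 * n * (n * (C * (G * rm))) <= 2 * C * G * (2 + D) * (n * rk).
Proof.
move=> C0 G0 n0 HS Hr; have CG : 0 <= 2 * C * G by rewrite !mulr_ge0.
have := ler_wpM2l CG HS; have := ler_wpM2l (mulr_ge0 CG n0) Hr; lra.
Qed.

End Numbers.

(** * Upper bounds for integrals of combinations of indicators *)

Section BoundedIntegral.
Context (R : realType) (dT : measure_display) (T : measurableType dT).
Context (mu : {measure set T -> \bar R}).

Definition integral_bounded (g : T -> R) (v : R) :=
  [/\ measurable_fun setT g, forall x, 0 <= g x &
      (\int[mu]_(x in setT) (g x)%:E <= v%:E)%E].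

Lemma integral_boundedD f g u v : integral_bounded f u -> integral_bounded g v ->
  integral_bounded (fun x => f x + g x) (u + v).
Proof.
move=> [mf f0 fu] [mg g0 gv]; split=> [|x|]; [exact: measurable_funD|exact: addr_ge0|].
under eq_integral do rewrite EFinD.
rewrite ge0_integralD//=; first by rewrite EFinD; exact: leeD.
- by move=> x _; rewrite lee_fin.
- exact/measurable_EFinP.
- by move=> x _; rewrite lee_fin.
- exact/measurable_EFinP.
Qed.

Lemma integral_boundedZ c g v : 0 <= c -> integral_bounded g v ->
  integral_bounded (fun x => c * g x) (c * v).
Proof.
move=> c0 [mg g0 gv]; split=> [|x|]; [exact: measurable_funM|exact: mulr_ge0|].
under eq_integral do rewrite EFinM.
rewrite ge0_integralZl_EFin//; first by rewrite EFinM lee_wpmul2l// lee_fin.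
- by move=> x _; rewrite lee_fin.
- exact/measurable_EFinP.
Qed.

Lemma integral_bounded_sum (I : Type) (s : seq I) (g : I -> T -> R) (v : I -> R) :
  (forall i, integral_bounded (g i) (v i)) ->
  integral_bounded (fun x => \sum_(i <- s) g i x) (\sum_(i <- s) v i).
Proof.
move=> H; elim: s => [|i s IH].
  rewrite big_nil (_ : (fun=> _) = (fun=> 0)); last by apply/funext => x; rewrite big_nil.
  by split=> //; rewrite integral0.
rewrite big_cons (_ : (fun=> _) = (fun x => g i x + \sum_(j <- s) g j x)); last first.
  by apply/funext => x; rewrite big_cons.
exact: integral_boundedD.
Qed.

Lemma integral_bounded_indic (A : set T) v : measurable A -> (mu A <= v%:E)%E ->
  integral_bounded (\1_A) v.
Proof.
move=> mA Av; split=> [|x|]; [exact: measurable_indic|by rewrite indicE|].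
by rewrite integral_indic// setIT.
Qed.

End BoundedIntegral.

(** * Choice of the generations and of the constant *)

Theorem theorem7 (R : realType) (d : nat)
  (lam : {measure set (d.-tuple R) -> \bar R})
  (nu : probability (d.-tuple (d.-tuple R)) R)
  (E Om : set (d.-tuple R)) (beta c' a b : R) :
  (2 <= d)%N ->
  is_lebesgue_d lam ->
  is_haar_SO nu ->
  measurable E -> ebounded E -> (0 < lam E)%E ->
  (exists c1 : R, 0 < c1 /\
     forall x r, E x -> 0 < r -> r < ediam E ->
       c1 * r ^+ d <= mu_E lam E (eball x r)) ->
  measurable Om -> ebounded Om ->
  0 < beta -> beta <= 1 -> 0 < c' ->
  (forall t : R, 0 < t -> t < 1 ->
     (lam (boundary_nbhd Om t) <= (c' * t `^ beta)%:E)%E) ->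
  0 < a -> a < b ->
  exists c : R, 0 < c /\
    forall N : nat, exists z : 'I_N -> d.-tuple R,
      injective z /\ (forall i, E (z i)) /\
      ((\int[lebesgue_measure]_(tau in `[a, b])
          \int[nu]_(M in setT)
            \int[lam]_(x in setT)
              ((discrepancy lam E z (moved x tau (mx_of M) Om)) ^+ 2)%:E)
        `^ (2^-1) <= (c * N%:R `^ (2^-1 - beta / (2 * d%:R)))%:E)%E.
Proof.
move=> d2 lamE [nuSO _] mE bE E0 _ mOm bOm beta0 beta1 c'0 HOm a0 ab.
have d0 : (0 < d)%N by exact: ltnW.
have [L L0 HL] := ebounded_coord bE.
have EL : E `<=` cube L by move=> x Ex i; rewrite -ler_norml; exact: HL.
pose T : R := d%:R * (2 * L).
have T0 : 0 < T by rewrite mulr_gt0 ?ltr0n// mulr_gt0.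
have [C C0 HC] := cutting_bound lamE bOm a0 ab beta0 c'0 HOm T0.
pose rho : R := 2^-1 `^ beta.
have rho0 : 0 < rho by rewrite powR_gt0// invr_gt0.
pose D := nchild d.
(* [D = 2 ^ d] is at least 4 because [d >= 2], and [rho] is at least 1/2 because [beta <= 1]. *)
have D2 : 2 <= D%:R * rho.
  have : 2^-1 <= rho.
    rewrite /rho -[leLHS](powRr1 (a := 2^-1)) ?invr_ge0//.
    by rewrite /powR gt_eqF ?invr_gt0// ler_expR ler_wnM2r// ln_le0// invf_le1// ler1n.
  have : (4 <= D)%N by rewrite /D nchildE -[X in (X <= _)%N]/(2 ^ 2)%N leq_exp2l.
  rewrite -(ler_nat R).
  by nra.
pose G := T `^ beta.
have G0 : 0 <= G by exact: powR_ge0.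
have diam_gt0 k : 0 < d%:R * (2 * L / 2 ^+ k) :> R.
  by rewrite mulr_gt0 ?ltr0n// divr_gt0 ?exprn_gt0// mulr_gt0.
have diam_le k : d%:R * (2 * L / 2 ^+ k) <= T.
  by rewrite mulrA ler_piMr ?(ltW T0)// invf_le1 ?exprn_gt0// exprn_ege1// ler1n.
have diam_powR k : (d%:R * (2 * L / 2 ^+ k)) `^ beta = G * rho ^+ k.
  rewrite mulrA powRM ?(ltW T0) ?invr_ge0 ?exprn_ge0//.
  by rewrite -exprVn powRX ?invr_ge0.
pose K := 2 * C * G * (2 + D%:R) * rho^-1.
have K0 : 0 <= K by rewrite /K !mulr_ge0 ?invr_ge0 ?(ltW rho0) ?addr_ge0.
have ba0 : 0 < b - a by lra.
(* The added 1 makes the constant positive even if [K] is 0. *)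
exists ((K * (b - a)) `^ 2^-1 + 1); split; first by rewrite ltr_wpDl ?powR_ge0.
move=> N; have [->|N0] := posnP N.
  exists (fun=> [tuple 0 | i < d]); split; first by case.
  split; first by case.
  rewrite (_ : integral _ _ _ = 0%E).
    by rewrite poweR0r ?lee_fin ?mulr_ge0 ?powR_ge0 ?addr_ge0 ?powR_ge0.
  apply: integral0_eq => tau _; apply: integral0_eq => M _; apply: integral0_eq => x _.
  rewrite /discrepancy mul0r subr0 (_ : #|_| = 0%N) ?expr0n//.
  by apply: eq_card0 => -[].
have D1 : (1 < D)%N by rewrite /D nchildE -{1}(expn0 2) ltn_exp2l// ltnW.
(* [D ^ k <= N < D ^ k.+1]: cubes of generation [k] have side of order [N] to the power [-1 / d]. *)
have /andP[k1 k2] := trunc_log_bounds D1 N0.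
set k := trunc_log D N in k1 k2.
(* These [j] further generations gain a factor [N], which brings the bias down to the order of the
   variance. *)
have [j Hj] := half_powR_small beta0 (ler0n R N).
pose m := (k + j)%N.
have km : (k <= m)%N by exact: leq_addr.
have [l [Hl sl]] := sum_level (nchild_gt0 d) (cumul_homo m N lamE L0 mE EL E0)
  (ltW rho0) D2 km k1.
have [r [u [Hr Hx]]] := sampling d0 lamE L0 mE EL E0 a0 mOm Hl.
pose w (i : 'I_N) (n : 'I_(nchild d ^ m)) := weight (cumul lam E L m N) i n.
have w0 i n : 0 <= w i n by exact: weight_ge0 (cumul_homo m N lamE L0 mE EL E0).
have w1 i : \sum_n w i n = 1 by exact: weight_sum.
pose B := K * N%:R `^ (1 - beta / d%:R).
have B0 : 0 <= B by rewrite mulr_ge0 ?powR_ge0.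
(* For a fixed dilation and rotation, the sum over the choices moves inside the integral over [x],
   where [sampling] bounds it by a combination of indicators of cutting sets. *)
have avg tau (M : d.-tuple (d.-tuple R)) : a <= tau <= b -> SOd (mx_of M) ->
    (\sum_om (choice_weight w om)%:E * \int[lam]_(x in setT)
      ((discrepancy lam E (fun i => r i (om i)) (moved x tau (mx_of M) Om)) ^+ 2)%:E <= B%:E)%E.
  move=> /andP[atau taub] [MM _].
  apply: le_trans.
    apply: (@lower_integral_sum _ _ R lam _ _ _ (choice_weight w)
      (fun om x => ((discrepancy lam E (fun i => r i (om i)) (moved x tau (mx_of M) Om)) ^+ 2)%:E)).
      by move=> om; exact: choice_weight_ge0.
    by move=> om x _; rewrite lee_fin sqr_ge0.
  have cb v t : 0 < t -> t <= T ->
      integral_bounded lam (\1_(cutting Om a (mx_of M) tau v t)) (C * t `^ beta).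
    move=> t0 tT; have [? ?] := HC (mx_of M) tau v t MM atau taub t0 tT.
    exact: integral_bounded_indic.
  have [_ g0 gB] := integral_boundedD
    (integral_boundedZ (ler0n R 2) (integral_bounded_sum (index_enum 'I_N)
      (fun i => cb (u i) _ (diam_gt0 (l i)) (diam_le (l i)))))
    (integral_boundedZ (mulr_ge0 (ler0n R 2) (ler0n R N)) (integral_bounded_sum (index_enum 'I_N)
      (fun i => integral_bounded_sum (index_enum 'I_(nchild d ^ m))
        (fun n => integral_boundedZ (w0 i n) (cb (r i n) _ (diam_gt0 m) (diam_le m)))))).
  apply: le_trans (le_trans _ gB) _.
    apply: lower_integral_le => x _.
      by apply: sume_ge0 => om _; rewrite -EFinM lee_fin mulr_ge0 ?choice_weight_ge0 ?sqr_ge0.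
    under eq_bigr do rewrite -EFinM.
    by rewrite sumEFin lee_fin; exact: Hx.
  rewrite lee_fin.
  under eq_bigr do rewrite diam_powR.
  under [X in _ + _ * X]eq_bigr do rewrite -mulr_suml w1 mul1r diam_powR.
  rewrite sumr_const card_ord -!mulr_sumr.
  apply: (@le_trans _ _ (2 * C * G * (2 + D%:R) * (N%:R * rho ^+ k))); last first.
    rewrite /B /K -[leRHS]mulrA ler_wpM2l ?mulr_ge0 ?addr_ge0//.
    by apply: half_powR_scale => //; rewrite -nchildE ltnW.
  have Nm : N%:R * rho ^+ m <= rho ^+ k.
    by rewrite exprD mulrCA ler_piMr// exprn_ge0// ltW.
  by rewrite -[X in _ + _ * X]mulr_natl; apply: variance_bias_le.
have mZ : measurable [set M : d.-tuple (d.-tuple R) | ~ SOd (mx_of M)].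
  by apply: (@measurableC _ _ [set M | SOd (mx_of M)]); exact: measurable_SOd.
pose F (om : {ffun 'I_N -> 'I_(nchild d ^ m)}) tau (M : d.-tuple (d.-tuple R)) :=
  (\int[lam]_(x in setT)
    ((discrepancy lam E (fun i => r i (om i)) (moved x tau (mx_of M) Om)) ^+ 2)%:E)%E.
have F0 om tau M : (0 <= F om tau M)%E.
  by apply: integral_ge0 => x _; rewrite lee_fin sqr_ge0.
have [om [p0 Jom]] := exists_le_average (choice_weight_ge0 w0) (sum_choice_weight w1) ab B0
  F0 mZ nuSO (fun tau M taub nZ => avg tau M taub (contrapT nZ)).
have [zinj zE] := Hr om p0.
exists (fun i => r i (om i)); split=> //; split=> //.
have BB : (B * (b - a)) `^ 2^-1 =
    (K * (b - a)) `^ 2^-1 * N%:R `^ (2^-1 - beta / (2 * d%:R)).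
  rewrite /B mulrAC [LHS]powRM ?powR_ge0 ?(mulr_ge0 K0 (ltW ba0))// -[X in _ * X]powRrM.
  suff -> : (1 - beta / d%:R) * 2^-1 = 2^-1 - beta / (2 * d%:R) by [].
  by field; rewrite pnatr_eq0 -lt0n.
apply: (@le_trans _ _ ((B * (b - a))%:E `^ 2^-1)%E).
  apply: gt0_ler_poweR => //; rewrite ?in_itv/= ?leey ?andbT.
  - by apply: integral_ge0 => tau _; apply: integral_ge0 => M _; apply: integral_ge0 => x _;
      rewrite lee_fin sqr_ge0.
  - by rewrite lee_fin mulr_ge0// ltW.
rewrite poweR_EFin lee_fin BB ler_wpM2r ?powR_ge0// lerDl ler01//.
Qed.
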